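(* In $\overline{\overline{\mathcal H}}{}^r$, modulo the rest of its axioms: (a) axiom (r8) is equivalent to the relation $$\alpha_2\circ(\mathrm{id}_H\diamond\sigma)=\sigma\circ\epsilon\qquad\text{(q)}$$ (i.e. in the presence of all axioms of $\overline{\overline{\mathcal H}}{}^r$ other than (r8), the relations (r8) and (q) are equivalent); (b) axiom (r9) is equivalent to the relation $$(\alpha_1\diamond\mathrm{id}_H)\circ(\mathrm{id}_H\diamond\gamma)\circ(\Delta\diamond\mathrm{id}_H)=\bar\gamma\circ(\mathrm{id}_H\diamond\alpha_1)\circ(\Delta\diamond\mathrm{id}_H)\qquad\text{(h10)}$$ (i.e. in the presence of all axioms of $\overline{\overline{\mathcal H}}{}^r$ other than (r9), the relations (r9) and (h10) are equivalent). Therefore $\overline{\overline{\mathcal H}}{}^r$ is equivalent to the universal strict braided monoidal category generated by the same elementary morphisms and axioms as $\overline{\overline{\mathcal H}}{}^r$, except that axioms (r8) and (r9) are replaced by relations (q) and (h10).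
   Context: Let $(\mathcal C,\diamond,\mathbf 1,\gamma)$ be a braided monoidal category with product $\diamond$, unit object $\mathbf 1$ and braiding $\gamma$ (associativity and unit constraints are suppressed); for an object $H$ write $\gamma=\gamma_{H,H}$, $\bar\gamma=\gamma^{-1}$, $\mathrm{id}=\mathrm{id}_H$. A (braided) Hopf algebra in $\mathcal C$ is an object $H$ with morphisms $\Delta:H\to H\diamond H$, $\epsilon:H\to\mathbf 1$, $m:H\diamond H\to H$, $\eta:\mathbf 1\to H$, $S,\bar S:H\to H$ such that (a1) $(\Delta\diamond\mathrm{id})\circ\Delta=(\mathrm{id}\diamond\Delta)\circ\Delta$; (a2-2') $(\epsilon\diamond\mathrm{id})\circ\Delta=\mathrm{id}=(\mathrm{id}\diamond\epsilon)\circ\Delta$; (a3) $m\circ(m\diamond\mathrm{id})=m\circ(\mathrm{id}\diamond m)$; (a4-4') $m\circ(\mathrm{id}\diamond\eta)=\mathrm{id}=m\circ(\eta\diamond\mathrm{id})$; (a5) $(m\diamond m)\circ(\mathrm{id}\diamond\gamma\diamond\mathrm{id})\circ(\Delta\diamond\Delta)=\Delta\circ m$; (a6) $\epsilon\circ m=\epsilon\diamond\epsilon$; (a7) $\Delta\circ\eta=\eta\diamond\eta$; (a8) $\epsilon\circ\eta=\mathrm{id}_{\mathbf 1}$; (s1) $m\circ(S\diamond\mathrm{id})\circ\Delta=\eta\circ\epsilon$; (s1') $m\circ(\mathrm{id}\diamond S)\circ\Delta=\eta\circ\epsilon$; (s2-2') $S\circ\bar S=\bar S\circ S=\mathrm{id}$.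 A unimodular Hopf algebra is a Hopf algebra with an integral $L:\mathbf 1\to H$ and a cointegral $l:H\to\mathbf 1$ such that (i1) $(\mathrm{id}\diamond l)\circ\Delta=\eta\circ l$; (i2) $m\circ(L\diamond\mathrm{id})=L\circ\epsilon$; (i3) $l\circ L=\mathrm{id}_{\mathbf 1}$; (i4) $S\circ L=L$; (i5) $l\circ S=l$. A (braided) ribbon Hopf algebra is a unimodular Hopf algebra with an invertible ribbon morphism $v:H\to H$ and a copairing $\sigma:\mathbf 1\to H\diamond H$ such that (r3) $S\circ v=v\circ S$; (r4) $\epsilon\circ v=\epsilon$; (r5) $m\circ(v\diamond\mathrm{id})=v\circ m$; (r6) $\sigma=(v^{-1}\diamond(v^{-1}\circ S))\circ\Delta\circ v\circ\eta$; (r7) $(\Delta\diamond\mathrm{id})\circ\sigma=(\mathrm{id}\diamond\mathrm{id}\diamond m)\circ(\mathrm{id}\diamond\sigma\diamond\mathrm{id})\circ\sigma$; (r8) $\Delta\circ v^{-1}=(v^{-1}\diamond v^{-1})\circ\mu\circ\bar\gamma\circ\Delta$; (r9) $(m\diamond m)\circ(S\diamond(\mu\circ\bar\gamma\circ\mu)\diamond S)\circ(\rho_l\diamond\rho_r)=\gamma$, where $\mu=(m\diamond m)\circ(\mathrm{id}\diamond\sigma\diamond\mathrm{id}):H\diamond H\to H\diamond H$, $\rho_l=(\mathrm{id}\diamond m)\circ(\sigma\diamond\mathrm{id}):H\to H\diamond H$, $\rho_r=(m\diamond\mathrm{id})\circ(\mathrm{id}\diamond\sigma):H\to H\diamond H$.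 $\mathcal H^r$ is the strict braided monoidal category freely generated by a ribbon Hopf algebra $H$ (objects $H^{\diamond n}$; morphisms generated under $\circ$ and $\diamond$ by the structure morphisms $\Delta,\epsilon,m,\eta,S,\bar S,L,l,v,v^{-1},\sigma$ of a ribbon Hopf algebra and the braiding, modulo the ribbon Hopf algebra axioms (a1)-(a8), (s1)-(s2-2'), (i1)-(i5), (r3)-(r9) and those of a strict braided monoidal category). The universal selfdual ribbon Hopf algebra $\overline{\overline{\mathcal H}}{}^r$ is the quotient of $\mathcal H^r$ by the further axioms (d) $(l\diamond\mathrm{id})\circ\sigma=L$; (n) $l\circ v\circ\eta=\mathrm{id}_{\mathbf 1}$. The (left) adjoint morphisms are $\alpha_1=m\circ(m\diamond S)\circ(\mathrm{id}\diamond\gamma)\circ(\Delta\diamond\mathrm{id}):H\diamond H\to H$ and $\alpha_2=(\alpha_1\diamond\alpha_1)\circ(\mathrm{id}\diamond\gamma\diamond\mathrm{id})\circ(\Delta\diamond\mathrm{id}_{H\diamond H}):H\diamond H^{\diamond2}\to H^{\diamond2}$. Relation (q) says that the copairing intertwines with the adjoint morphism. *)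

(* Defs.v *)
(* MathComp *)
From mathcomp Require Import all_boot.

Set Implicit Arguments.
Unset Strict Implicit.
Unset Printing Implicit Defensive.

Declare Scope mor_scope.
Delimit Scope mor_scope with mor.

(** * Strict braided monoidal categories *)

(* Strictness is an equality of objects, so comparing morphisms across it
   requires transport of their source and target. *)
Definition castm (O : Type) (hom : O -> O -> Type) (a a' b b' : O)
    (ea : a = a') (eb : b = b') (f : hom a b) : hom a' b' :=
  ecast x (hom x b') ea (ecast y (hom a y) eb f).

Record sbm_ops := SbmOps {
  ob : Type;
  hom : ob -> ob -> Type;
  one : ob;
  oten : ob -> ob -> ob;
  otenA : forall a b c, oten a (oten b c) = oten (oten a b) c;
  oten1o : forall a, oten one a = a;
  oteno1 : forall a, oten a one = a;
  ident : forall a, hom a a;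
  comp : forall a b c, hom b c -> hom a b -> hom a c;
  ten : forall a b c d, hom a b -> hom c d -> hom (oten a c) (oten b d);
  braid : forall a b, hom (oten a b) (oten b a);
  ibraid : forall a b, hom (oten b a) (oten a b)
}.

(* Hom-sets are setoids: [E] is the equality of parallel morphisms. *)
Record sbm_laws (C : sbm_ops)
    (E : forall a b : ob C, hom a b -> hom a b -> Prop) : Prop := SbmLaws {
  law_refl : forall a b (f : hom a b), E _ _ f f;
  law_sym : forall a b (f g : hom a b), E _ _ f g -> E _ _ g f;
  law_trans : forall a b (f g h : hom a b),
    E _ _ f g -> E _ _ g h -> E _ _ f h;
  law_comp : forall a b c (f f' : hom b c) (g g' : hom a b),
    E _ _ f f' -> E _ _ g g' -> E _ _ (comp f g) (comp f' g');
  law_ten : forall a b c d (f f' : hom a b) (g g' : hom c d),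
    E _ _ f f' -> E _ _ g g' -> E _ _ (ten f g) (ten f' g');

  law_compA : forall a b c d (f : hom c d) (g : hom b c) (h : hom a b),
    E _ _ (comp f (comp g h)) (comp (comp f g) h);
  law_comp1f : forall a b (f : hom a b), E _ _ (comp (ident b) f) f;
  law_compf1 : forall a b (f : hom a b), E _ _ (comp f (ident a)) f;

  law_ten_id : forall a b, E _ _ (ten (ident a) (ident b)) (ident (oten a b));
  law_interchange : forall a b c a' b' c'
      (f : hom b c) (g : hom a b) (f' : hom b' c') (g' : hom a' b'),
    E _ _ (ten (comp f g) (comp f' g')) (comp (ten f f') (ten g g'));
  law_tenA : forall a b c a' b' c'
      (f : hom a a') (g : hom b b') (h : hom c c'),
    E _ _ (castm (otenA a b c) (otenA a' b' c') (ten f (ten g h)))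
          (ten (ten f g) h);
  law_ten1f : forall a b (f : hom a b),
    E _ _ (castm (oten1o a) (oten1o b) (ten (ident (one C)) f)) f;
  law_tenf1 : forall a b (f : hom a b),
    E _ _ (castm (oteno1 a) (oteno1 b) (ten f (ident (one C)))) f;

  law_braidK : forall a b,
    E _ _ (comp (ibraid a b) (braid a b)) (ident (oten a b));
  law_ibraidK : forall a b,
    E _ _ (comp (braid a b) (ibraid a b)) (ident (oten b a));
  law_braid_nat : forall a b a' b' (f : hom a a') (g : hom b b'),
    E _ _ (comp (ten g f) (braid a b)) (comp (braid a' b') (ten f g));
  law_hexagon_r : forall a b c,
    E _ _ (castm (otenA a b c) (esym (otenA b c a)) (braid a (oten b c)))
          (comp (ten (ident b) (braid a c))
                (castm erefl (esym (otenA b a c))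
                       (ten (braid a b) (ident c))));
  law_hexagon_l : forall a b c,
    E _ _ (castm (esym (otenA a b c)) (otenA c a b) (braid (oten a b) c))
          (comp (ten (braid a c) (ident b))
                (castm erefl (otenA a c b)
                       (ten (ident a) (braid b c))))
}.

Record sbm_cat := SbmCat {
  ops :> sbm_ops;
  heq : forall a b : ob ops, hom a b -> hom a b -> Prop;
  heq_laws : sbm_laws heq
}.

(** * Strict braided monoidal functors and equivalences *)

Record sbm_functor (C D : sbm_cat) := SbmFunctor {
  fob : ob C -> ob D;
  fhom : forall a b : ob C, hom a b -> hom (fob a) (fob b);
  fob1 : fob (one C) = one D;
  fobT : forall a b, fob (oten a b) = oten (fob a) (fob b);
  fhom_heq : forall a b (f g : hom a b), heq f g -> heq (fhom f) (fhom g);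
  fhom_id : forall a, heq (fhom (ident a)) (ident (fob a));
  fhom_comp : forall a b c (f : hom b c) (g : hom a b),
    heq (fhom (comp f g)) (comp (fhom f) (fhom g));
  fhom_ten : forall a b c d (f : hom a b) (g : hom c d),
    heq (castm (fobT a c) (fobT b d) (fhom (ten f g)))
        (ten (fhom f) (fhom g));
  fhom_braid : forall a b,
    heq (castm (fobT a b) (fobT b a) (fhom (braid a b)))
        (braid (fob a) (fob b))
}.

(* A monoidal natural isomorphism from the identity functor of [C] to the
   composite of [F] followed by [G]. *)
Record unit_iso (C D : sbm_cat) (F : sbm_functor C D) (G : sbm_functor D C) :=
  UnitIso {
  ucomp : forall a : ob C, hom a (fob G (fob F a));
  uinv : forall a : ob C, hom (fob G (fob F a)) a;
  ucompK : forall a, heq (comp (uinv a) (ucomp a)) (ident a);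
  uinvK : forall a, heq (comp (ucomp a) (uinv a)) (ident (fob G (fob F a)));
  unat : forall a b (f : hom a b),
    heq (comp (fhom G (fhom F f)) (ucomp a)) (comp (ucomp b) f);
  uone : heq (castm erefl (etrans (congr1 (fob G) (fob1 F)) (fob1 G))
                    (ucomp (one C)))
             (ident (one C));
  uten : forall a b,
    heq (castm erefl (etrans (congr1 (fob G) (fobT F a b))
                             (fobT G (fob F a) (fob F b)))
               (ucomp (oten a b)))
        (ten (ucomp a) (ucomp b))
}.

Record sbm_equiv (C D : sbm_cat) := SbmEquiv {
  efun : sbm_functor C D;
  einv : sbm_functor D C;
  eunit : unit_iso efun einv;
  ecounit : unit_iso einv efun
}.

(** * Terms over the elementary morphisms *)

(* The object n is the n-fold product of H with itself. *)
Inductive elem : nat -> nat -> Type :=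
| eDelta : elem 1 2
| eeps : elem 1 0
| emul : elem 2 1
| eeta : elem 0 1
| eS : elem 1 1
| eSbar : elem 1 1
| eL : elem 0 1
| el : elem 1 0
| ev : elem 1 1
| evbar : elem 1 1
| esigma : elem 0 2.

Inductive tm : nat -> nat -> Type :=
| Elem a b : elem a b -> tm a b
| Id a : tm a a
| Comp a b c : tm b c -> tm a b -> tm a c
| Ten a b c d : tm a b -> tm c d -> tm (a + c) (b + d)
| Braid a b : tm (a + b) (b + a)
| Ibraid a b : tm (b + a) (a + b).

Definition tm_ops : sbm_ops :=
  @SbmOps nat tm 0 addn addnA add0n addn0 Id Comp Ten Braid Ibraid.

Bind Scope mor_scope with tm.
Notation "f ∘ g" := (Comp f g) (at level 50, left associativity) : mor_scope.
Notation "f ⋄ g" := (Ten f g) (at level 40, left associativity) : mor_scope.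

Local Open Scope mor_scope.

Definition idH : tm 1 1 := Id 1.
Definition γ : tm 2 2 := Braid 1 1.
Definition γbar : tm 2 2 := Ibraid 1 1.
Definition Δ : tm 1 2 := Elem eDelta.
Definition ε : tm 1 0 := Elem eeps.
Definition m : tm 2 1 := Elem emul.
Definition η : tm 0 1 := Elem eeta.
Definition SH : tm 1 1 := Elem eS.
Definition SbarH : tm 1 1 := Elem eSbar.
Definition L : tm 0 1 := Elem eL.
Definition l : tm 1 0 := Elem el.
Definition v : tm 1 1 := Elem ev.
Definition vbar : tm 1 1 := Elem evbar.
Definition σ : tm 0 2 := Elem esigma.

Definition μ : tm 2 2 := (m ⋄ m) ∘ (idH ⋄ σ ⋄ idH).
Definition ρl : tm 1 2 := (idH ⋄ m) ∘ (σ ⋄ idH).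
Definition ρr : tm 1 2 := (m ⋄ idH) ∘ (idH ⋄ σ).
Definition α1 : tm 2 1 := m ∘ (m ⋄ SH) ∘ (idH ⋄ γ) ∘ (Δ ⋄ idH).
Definition α2 : tm 3 2 := (α1 ⋄ α1) ∘ (idH ⋄ γ ⋄ idH) ∘ (Δ ⋄ Id 2).

(** * Axioms *)

Record eqn := Eqn { esrc : nat; etgt : nat;
                    elhs : tm esrc etgt; erhs : tm esrc etgt }.

Inductive ax :=
| ax_a1 | ax_a2 | ax_a2' | ax_a3 | ax_a4 | ax_a4' | ax_a5 | ax_a6 | ax_a7
| ax_a8
| ax_s1 | ax_s1' | ax_s2 | ax_s2'
| ax_i1 | ax_i2 | ax_i3 | ax_i4 | ax_i5
| ax_vK | ax_vbarK | ax_r3 | ax_r4 | ax_r5 | ax_r6 | ax_r7 | ax_r8 | ax_r9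
| ax_d | ax_n
| ax_q | ax_h10.

Definition ax_eqn (x : ax) : eqn :=
  match x with
  | ax_a1 => @Eqn 1 3 ((Δ ⋄ idH) ∘ Δ) ((idH ⋄ Δ) ∘ Δ)
  | ax_a2 => @Eqn 1 1 ((ε ⋄ idH) ∘ Δ) idH
  | ax_a2' => @Eqn 1 1 ((idH ⋄ ε) ∘ Δ) idH
  | ax_a3 => @Eqn 3 1 (m ∘ (m ⋄ idH)) (m ∘ (idH ⋄ m))
  | ax_a4 => @Eqn 1 1 (m ∘ (idH ⋄ η)) idH
  | ax_a4' => @Eqn 1 1 (m ∘ (η ⋄ idH)) idH
  | ax_a5 => @Eqn 2 2 ((m ⋄ m) ∘ (idH ⋄ γ ⋄ idH) ∘ (Δ ⋄ Δ)) (Δ ∘ m)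
  | ax_a6 => @Eqn 2 0 (ε ∘ m) (ε ⋄ ε)
  | ax_a7 => @Eqn 0 2 (Δ ∘ η) (η ⋄ η)
  | ax_a8 => @Eqn 0 0 (ε ∘ η) (Id 0)
  | ax_s1 => @Eqn 1 1 (m ∘ (SH ⋄ idH) ∘ Δ) (η ∘ ε)
  | ax_s1' => @Eqn 1 1 (m ∘ (idH ⋄ SH) ∘ Δ) (η ∘ ε)
  | ax_s2 => @Eqn 1 1 (SH ∘ SbarH) idH
  | ax_s2' => @Eqn 1 1 (SbarH ∘ SH) idH
  | ax_i1 => @Eqn 1 1 ((idH ⋄ l) ∘ Δ) (η ∘ l)
  | ax_i2 => @Eqn 1 1 (m ∘ (L ⋄ idH)) (L ∘ ε)
  | ax_i3 => @Eqn 0 0 (l ∘ L) (Id 0)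
  | ax_i4 => @Eqn 0 1 (SH ∘ L) L
  | ax_i5 => @Eqn 1 0 (l ∘ SH) l
  | ax_vK => @Eqn 1 1 (vbar ∘ v) idH
  | ax_vbarK => @Eqn 1 1 (v ∘ vbar) idH
  | ax_r3 => @Eqn 1 1 (SH ∘ v) (v ∘ SH)
  | ax_r4 => @Eqn 1 0 (ε ∘ v) ε
  | ax_r5 => @Eqn 2 1 (m ∘ (v ⋄ idH)) (v ∘ m)
  | ax_r6 => @Eqn 0 2 σ ((vbar ⋄ (vbar ∘ SH)) ∘ Δ ∘ v ∘ η)
  | ax_r7 => @Eqn 0 3 ((Δ ⋄ idH) ∘ σ) ((idH ⋄ idH ⋄ m) ∘ (idH ⋄ σ ⋄ idH) ∘ σ)
  | ax_r8 => @Eqn 1 2 (Δ ∘ vbar) ((vbar ⋄ vbar) ∘ μ ∘ γbar ∘ Δ)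
  | ax_r9 => @Eqn 2 2 ((m ⋄ m) ∘ (SH ⋄ (μ ∘ γbar ∘ μ) ⋄ SH) ∘ (ρl ⋄ ρr)) γ
  | ax_d => @Eqn 0 1 ((l ⋄ idH) ∘ σ) L
  | ax_n => @Eqn 0 0 (l ∘ v ∘ η) (Id 0)
  | ax_q => @Eqn 1 2 (α2 ∘ (idH ⋄ σ)) (σ ∘ ε)
  | ax_h10 => @Eqn 2 2 ((α1 ⋄ idH) ∘ (idH ⋄ γ) ∘ (Δ ⋄ idH))
                       (γbar ∘ (idH ⋄ α1) ∘ (Δ ⋄ idH))
  end.

Definition hopf_ax (x : ax) : bool :=
  match x with
  | ax_a1 | ax_a2 | ax_a2' | ax_a3 | ax_a4 | ax_a4'
  | ax_a5 | ax_a6 | ax_a7 | ax_a8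
  | ax_s1 | ax_s1' | ax_s2 | ax_s2' => true
  | _ => false
  end.

Definition unimodular_ax (x : ax) : bool :=
  hopf_ax x ||
  match x with
  | ax_i1 | ax_i2 | ax_i3 | ax_i4 | ax_i5 => true
  | _ => false
  end.

Definition ribbon_ax (x : ax) : bool :=
  unimodular_ax x ||
  match x with
  | ax_vK | ax_vbarK | ax_r3 | ax_r4 | ax_r5 | ax_r6 | ax_r7 | ax_r8 | ax_r9 =>
      true
  | _ => false
  end.

Definition selfdual_ax (x : ax) : bool :=
  ribbon_ax x || match x with ax_d | ax_n => true | _ => false end.

Definition selfdual_ax_qh (x : ax) : bool :=
  match x with
  | ax_r8 | ax_r9 => false
  | ax_q | ax_h10 => true
  | _ => selfdual_ax x
  end.

(** * Presented categories *)

Definition tm_rel := forall a b : nat, tm a b -> tm a b -> Prop.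

(* The terms modulo [E] form a strict braided monoidal category. *)
Definition braided_congr (E : tm_rel) : Prop := @sbm_laws tm_ops E.

Definition holds (E : tm_rel) (x : ax) : Prop :=
  E _ _ (elhs (ax_eqn x)) (erhs (ax_eqn x)).

Definition generated (A : ax -> bool) : tm_rel := fun a b f g =>
  forall E : tm_rel,
    braided_congr E -> (forall x, A x -> holds E x) -> E a b f g.

Lemma generated_laws A : @sbm_laws tm_ops (@generated A).
Proof.
split; rewrite /generated /=.
- by move=> a b f E EL _; apply: (law_refl EL).
- by move=> a b f g Efg E EL EA; apply: (law_sym EL); apply: Efg.
- move=> a b f g h Efg Egh E EL EA.
  by apply: (law_trans EL (Efg E EL EA)); apply: Egh.
- move=> a b c f f' g g' Ef Eg E EL EA.
  by apply: (law_comp EL); [apply: Ef | apply: Eg].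
- move=> a b c e f f' g g' Ef Eg E EL EA.
  by apply: (law_ten EL); [apply: Ef | apply: Eg].
- by move=> a b c e f g h E EL _; apply: (law_compA EL).
- by move=> a b f E EL _; apply: (law_comp1f EL).
- by move=> a b f E EL _; apply: (law_compf1 EL).
- by move=> a b E EL _; apply: (law_ten_id EL).
- by move=> a b c a' b' c' f g f' g' E EL _; apply: (law_interchange EL).
- by move=> a b c a' b' c' f g h E EL _; apply: (law_tenA EL).
- by move=> a b f E EL _; apply: (law_ten1f EL).
- by move=> a b f E EL _; apply: (law_tenf1 EL).
- by move=> a b E EL _; apply: (law_braidK EL).
- by move=> a b E EL _; apply: (law_ibraidK EL).
- by move=> a b a' b' f g E EL _; apply: (law_braid_nat EL).
- by move=> a b c E EL _; apply: (law_hexagon_r EL).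
- by move=> a b c E EL _; apply: (law_hexagon_l EL).
Qed.

Definition presented (A : ax -> bool) : sbm_cat := SbmCat (@generated_laws A).

Definition preserves_elem (A B : ax -> bool)
    (F : sbm_functor (presented A) (presented B)) : Prop :=
  exists Fob : forall k : nat, fob F k = k,
  forall (a b : nat) (e : elem a b),
    heq (castm (Fob a) (Fob b) (@fhom _ _ F a b (Elem e)))
        (Elem e : @hom (presented B) a b).

(* Main.v *)
From HB Require Import structures.
From mathcomp Require Import all_boot zify.
Require Import Defs.

(** The proof works modulo the axioms other than r8 and r9.  Read x ▷ y for the
adjoint action [α1] and call [cocommutes α1] the relation h10: it says that in
x(1) ▷ y and x(2) one may let x(2) act instead of x(1), up to the braiding.

Put W := (idH ⋄ SbarH) ∘ σ.  Axiom r6 gives W = (vbar ⋄ vbar) ∘ Δ ∘ v ∘ η, so W is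
symmetric up to antipodes and braiding ([W_flip]), and r7 becomes multiplicativity
of W in both legs ([W_comulL], [W_comulR]).  Hence σ is the inverse of W in the
braided tensor square of H, and since v is central both W and σ commute with
every Δ(x) ([W_central], [σ_central]).  Axiom (d) and the integrals make W
nondegenerate, so that one of its legs can be cancelled ([W_cancel]).  Cancelling a
leg in a consequence of [W_central] shows that the adjoint action of the first leg of W
on a strand is the adjoint coaction of that strand ([adjoint_W]).

This collapses the left side of r9 to an expression in the mirror image of the
adjoint action ([r9_lhs]), and r9 turns into the statement that the mirror action
cocommutes.  If one of the two actions cocommutes then they are equal, whence
r9 and h10 are equivalent ([r9_cocommutes]).  Moreover h10 implies both q and r8
([cocommutes_q], [cocommutes_r8]): for q, the product Δ(x)σ is (x(1) ▷ σ)Δ(x(2)) and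
σ is central; for r8, cocommutation yields the analogue of [adjoint_W] for σ, with which
σΔ(x) becomes the right side of r8.  So as soon as r9 or h10 holds, all four
relations hold, and the two presentations define the same congruence on terms:
the identity on terms is the equivalence.

The string-diagram computations are done by reflection.  A term is flattened to
a word of elementary layers, the word is brought to a normal form by sound
rewriting rules, and two normal forms are compared by solving the word problem of
the braid formed by their crossings, up to the braids that the copairings created before
it absorb.  The tactic [by_diagram] proves an equation by this comparison, and
[via C h] rewrites with an equation h inside the context C, which the left side of the
goal has to match only up to such a comparison. *)

Set Implicit Arguments.
Unset Strict Implicit.
Unset Printing Implicit Defensive.

Local Open Scope mor_scope.

(** * Words of elementary layers *)

Inductive gen := gD | gE | gM | gH | gS | gT | gL | gl | gv | gw | gσ | gX | gY.

Definition src g := match g with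
 gD => 1 | gE => 1 | gM => 2 | gH => 0 | gS => 1 | gT => 1 | gL => 0 | gl => 1
 | gv => 1 | gw => 1 | gσ => 0 | gX => 2 | gY => 2 end.

Definition tgt g := match g with
 gD => 2 | gE => 0 | gM => 1 | gH => 1 | gS => 1 | gT => 1 | gL => 1 | gl => 0
 | gv => 1 | gw => 1 | gσ => 2 | gX => 2 | gY => 2 end.

Definition term_of_gen g : tm (src g) (tgt g) := match g with
 gD => Δ | gE => ε | gM => m | gH => η | gS => SH | gT => SbarH | gL => L | gl => l
 | gv => v | gw => vbar | gσ => σ | gX => γ | gY => γbar end.

Definition gen_code g := match g with
 gD => 0 | gE => 1 | gM => 2 | gH => 3 | gS => 4 | gT => 5 | gL => 6 | gl => 7
 | gv => 8 | gw => 9 | gσ => 10 | gX => 11 | gY => 12 end.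

Definition gen_decode n := match n with
 0 => gD | 1 => gE | 2 => gM | 3 => gH | 4 => gS | 5 => gT | 6 => gL | 7 => gl
 | 8 => gv | 9 => gw | 10 => gσ | 11 => gX | _ => gY end.

Lemma gen_codeK : cancel gen_code gen_decode. Proof. by case. Qed.
HB.instance Definition _ := Equality.copy gen (can_type gen_codeK).

(** The pair (i, g) is the generator g with i strands on its left.  The number of
    strands on its right is left open, so that a word makes sense in any wider
    context.  Words are read from source to target. *)
Definition layer := (nat * gen)%type.
Definition word := seq layer.
Definition shift i (w : word) : word := [seq (i + x.1, x.2) | x <- w].

Definition gen_of a b (e : elem a b) := match e with
 eDelta => gD | eeps => gE | emul => gM | eeta => gH | eS => gS | eSbar => gT
 | eL => gL | el => gl | ev => gv | evbar => gw | esigma => gσ end.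

Fixpoint word_of a b (f : tm a b) : word := match f with
 | Elem _ _ e => [:: (0, gen_of e)]
 | Id _ => [::]
 | Comp _ _ _ f g => word_of g ++ word_of f
 | Ten _ b _ _ f g => word_of f ++ shift b (word_of g)
 | Braid _ _ => [:: (0, gX)]
 | Ibraid _ _ => [:: (0, gY)]
 end.

(** Letters exist only for the crossings of two single strands. *)
Fixpoint simple a b (f : tm a b) : bool := match f with
 | Elem _ _ e => true
 | Id _ => true
 | Comp _ _ _ f g => simple f && simple g
 | Ten _ b _ _ f g => simple f && simple g
 | Braid a b => (a == 1) && (b == 1)
 | Ibraid a b => (a == 1) && (b == 1)
 end.

(** * Rewriting to a normal form *)

(** The comparison with the width n matters for rules such as [idH ⋄ σ], whose
    source has strands that the word of the left side does not meet. *)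
Definition rewrite_head n (w : word) (r : eqn) : option word :=
  match word_of (elhs r), w with
  | (i0, _) :: _, (i1, _) :: _ =>
    let i := i1 - i0 in let lw := word_of (elhs r) in
    if [&& i0 <= i1, prefix (shift i lw) w & i + esrc r <= n]
    then Some (shift i (word_of (erhs r)) ++ drop (size lw) w) else None
  | _, _ => None
  end.

(** The order of generators in a normal form, from source to target: what consumes
    or splits strands comes first, what merges or relabels them comes last, and all
    crossings lie in between. *)
Definition rank g := match g with
 gE => 0 | gl => 0 | gD => 1 | gσ => 2 | gL => 2 | gX => 3 | gY => 3
 | gS => 4 | gT => 4 | gM => 4 | gv => 5 | gw => 5 | gH => 6 end.

(** Tells whether the layer (j, h), which follows (i, g), has to precede it.  The
    comparisons of positions give layers of equal rank a definite order. *)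
Definition moves_before g i h j := (rank h < rank g) || ((rank h == rank g) &&
  match rank g with
  | 0 => j < i | 1 => i.+1 < j | 4 => j < i | 5 => j < i | 6 => j <= i
  | _ => false end).

Definition swap_head (before : gen -> nat -> gen -> nat -> bool) (w : word) :
    option word :=
  match w with
  | (i, g) :: (j, h) :: s =>
    if before g i h j then
      if j + src h <= i then Some ((j, h) :: (i - src h + tgt h, g) :: s)
      else if i + tgt g <= j then Some ((j - tgt g + src g, h) :: (i, g) :: s)
      else None
    else None
  | _ => None
  end.

Fixpoint rewrite_head_any n w (rs : seq eqn) := match rs with
  | [::] => None
  | r :: rs' =>
    if rewrite_head n w r is Some w' then Some w' else rewrite_head_any n w rs'
  end.

Definition rewrite_step before rs n w :=
  if swap_head before w is Some w' then Some w' else rewrite_head_any n w rs.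

(** A zipper: [pre] lists in reverse order the layers already scanned, each with
    the width before it.  After a step the scan resumes two layers back, because the
    left sides of the rules have at most three layers. *)
Fixpoint rewrite_loop before rs fuel (pre : seq (nat * layer)) n (suf : word) : word :=
  match fuel, suf with
  | fuel'.+1, x :: s =>
    match rewrite_step before rs n suf with
    | Some suf' => match pre with
       | [::] => rewrite_loop before rs fuel' [::] n suf'
       | [:: (n0, y)] => rewrite_loop before rs fuel' [::] n0 (y :: suf')
       | (_, y) :: (n0, z) :: pre' => rewrite_loop before rs fuel' pre' n0 (z :: y :: suf') end
    | None => rewrite_loop before rs fuel' ((n, x) :: pre) (n - src x.2 + tgt x.2) s
    end
  | _, _ => catrev (map snd pre) suf
  end.

(** A failure to terminate within this bound could only make a comparison fail. *)
Definition fuel := 100 * 100 * 10.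
Definition normalize rs n w := rewrite_loop moves_before rs fuel [::] n w.

(** * Braid words *)

Definition crossing (e : bool) : tm 2 2 := if e then γ else γbar.
Definition crossing_gen (e : bool) := if e then gX else gY.

(** Moves a crossing to the right past its right neighbour, at the price of
    conjugating the neighbour: in the braid group,
    c(k)^e c(k+1)^d = c(k+1)^-e c(k)^d c(k+1)^e c(k)^e. *)
Definition pass_rule (e d : bool) : eqn := @Eqn 3 3
   ((idH ⋄ crossing d) ∘ (crossing e ⋄ idH))
   ((crossing e ⋄ idH) ∘ (idH ⋄ crossing e) ∘ (crossing d ⋄ idH) ∘
    (idH ⋄ crossing (~~ e))).

Definition cancel_rule (e : bool) : eqn := @Eqn 2 2
   (crossing (~~ e) ∘ crossing e) (Id 2).

Definition is_crossing g := (g == gX) || (g == gY).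

(** (k, true) and (k, false) are the two crossings of the strands k and k + 1. *)
Definition letter := (nat * bool)%type.
Definition braid := seq letter.
Definition layer_of (x : letter) : layer := (x.1, crossing_gen x.2).

(** A handle is a word c(k)^e v c(k)^-e where v contains neither c(k) nor c(k-1).
    Carrying its first letter through v cancels it against the last one and
    conjugates the letters c(k+1) of v. *)
Definition unhook k (e : bool) (v : seq letter) : seq letter :=
  flatten [seq if x.1 == k.+1 then [:: (k.+1, ~~ e); (k, x.2); (k.+1, e)]
                else [:: x] | x <- v].

(** Looks backwards from a letter (k, e) for the beginning of a handle that
    this letter ends. *)
Fixpoint find_handle k (e : bool) (pre v : seq letter) := match pre with
  | [::] => None
  | x :: p => if x.1 == k then (if x.2 == ~~ e then Some (p, v) else None)
              else if x.1.+1 == k then None else find_handle k e p (x :: v) end.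

(** Dehornoy's handle reduction, which solves the word problem of braid groups. *)
Fixpoint reduce_handles fuel (pre suf : seq letter) := match fuel, suf with
  | f.+1, x :: s => match find_handle x.1 x.2 pre [::] with
      | Some (p, v) => reduce_handles f p (unhook x.1 (~~ x.2) v ++ s)
      | None => reduce_handles f (x :: pre) s end
  | _, _ => catrev pre suf end.

Definition braid_reduce b := reduce_handles fuel [::] b.
Definition inv_braid (b : seq letter) := rev [seq (x.1, ~~ x.2) | x <- b].
Definition same_braid (b1 b2 : seq letter) := braid_reduce (b1 ++ inv_braid b2) == [::].
Definition crossing_layer (x : layer) := is_crossing x.2.
Definition letter_of (x : layer) : letter := (x.1, x.2 == gX).

(** In a normal form the crossings are consecutive, so this isolates the braid. *)
Definition cut_braid (w : word) :=
  let k := find crossing_layer w in let s := drop k w in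
  let j := find (predC crossing_layer) s in
  (take k w, map letter_of (take j s), drop j s).

(** * Births of the copairing *)

(** Naturality of the crossings with respect to σ: a strand may pass both legs of a
    copairing before these are created. *)
Definition birth_rules : seq eqn :=
  [:: @Eqn 1 3 ((γ ⋄ idH) ∘ (idH ⋄ γ) ∘ (σ ⋄ idH)) (idH ⋄ σ);
      @Eqn 1 3 ((γbar ⋄ idH) ∘ (idH ⋄ γbar) ∘ (σ ⋄ idH)) (idH ⋄ σ);
      @Eqn 1 3 ((idH ⋄ γ) ∘ (γ ⋄ idH) ∘ (idH ⋄ σ)) (σ ⋄ idH);
      @Eqn 1 3 ((idH ⋄ γbar) ∘ (γbar ⋄ idH) ∘ (idH ⋄ σ)) (σ ⋄ idH)].

(** Births go after crossings.  Of two births either one may come last, and which of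
    them has to depends on the braid; hence the parameter [left]. *)
Definition birth_after (left : bool) g i h j :=
  (g == gσ) && (is_crossing h || (h == gσ) && (if left then j <= i else i.+1 < j)).

Definition delay_births left n w := rewrite_loop (birth_after left) birth_rules fuel [::] n w.

Fixpoint width n (w : word) := match w with
  | [::] => n
  | (i, g) :: w' => width (n - src g + tgt g) w'
  end.

(** The braid c is absorbed by k copairings created to the left of n strands when
    postponing their creation beyond c leaves no crossing. *)
Definition slides_to left n k (c : seq letter) :=
  let w := delay_births left n (nseq k (0, gσ) ++ map layer_of c) in
  let j := find (predC crossing_layer) w in
  (braid_reduce (map letter_of (take j w)) == [::]) &&
  (drop j w == delay_births left n (nseq k (0, gσ))).

Definition slides n k c := all (fun x => x.1.+1 < n + k.*2) c &&
  (slides_to true n k c || slides_to false n k c).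

(** Braids absorbed by k copairings to the left of n strands: two neighbouring
    pairs of legs change places, one leg turns around the next pair, a pair passes
    between the legs of its neighbour, and one of the n strands turns around the
    last pair. *)
Definition slide_moves n k : seq (seq letter) :=
  let sgn e := map (fun i => (i, e)) in
  flatten [seq let a := p.*2 in flatten
    [seq [:: sgn e [:: a.+1; a.+2; a; a.+1]; sgn e [:: a.+1; a.+2; a.+2; a.+1];
             sgn e [:: a.+1; a; a; a.+1]; sgn e [:: a.+1; a.+2] ++ sgn (~~ e) [:: a; a.+1]]
    | e <- [:: true; false]] | p <- iota 0 k.-1] ++
  if k is k'.+1 then
    flatten [seq let a := k'.*2 in
      let o := flatten [seq sgn true [:: a.+1 + i; a + i] | i <- iota 0 j] in
      [seq o ++ sgn e [:: a.+1 + j; a + j; a + j; a.+1 + j] ++ inv_braid o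
      | e <- [:: true; false]]
    | j <- iota 0 n]
  else [::].

(** A braid, with the moves by which it has been multiplied on the left and on the
    right. *)
Definition state := (braid * (seq braid * seq braid))%type.

Fixpoint enqueue (n : nat) (x : state) (q : seq (nat * state)) := match q with
  | [::] => [:: (n, x)]
  | (n', y) :: q' => if n < n' then (n, x) :: q else (n', y) :: enqueue n x q' end.

Definition push (st : seq (nat * state) * seq braid) (x : state) :=
  let b := braid_reduce x.1 in
  if b \in st.2 then st else (enqueue (size b) (b, x.2) st.1, b :: st.2).

(** Best-first search, shortest braid first, for a factorization of the braid into
    slide moves.  Its outcome is a certificate that [same_up_to_slides] verifies. *)
Fixpoint search fuel (G : seq braid) (st : seq (nat * state) * seq braid) : seq braid :=
  match fuel, st.1 with
  | f.+1, (_, (b, (ls, rs))) :: q =>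
    if b == [::] then [seq inv_braid c | c <- rev ls] ++ [seq inv_braid c | c <- rs]
    else
      let try st c := push (push st (c ++ b, (c :: ls, rs))) (b ++ c, (ls, c :: rs)) in
      search f G (foldl try (q, st.2) G)
  | _, _ => [::]
  end.

Definition find_slides n k (b : braid) :=
  search 60 (slide_moves n k)
    (push ([::], [::]) (b, ([::], [::]))).

(** The order in which copairings are created and the way their legs are
    braided are not determined by the morphism.  The braids b1 and b2 may therefore
    differ by a braid that the copairings at the end of the prefix p absorb. *)
Definition same_up_to_slides n (p : word) b1 b2 :=
  let ds := [seq x <- p | x.2 != gσ] in
  let k := size p - size ds in
  let n' := width n ds in
  let cs := find_slides n' k (b1 ++ inv_braid b2) in
  [&& p == ds ++ nseq k (0, gσ), all (slides n' k) cs & same_braid b1 (flatten cs ++ b2)].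

Definition same_word n w1 w2 :=
  let: (p1, b1, s1) := cut_braid w1 in let: (p2, b2, s2) := cut_braid w2 in
  [&& p1 == p2, s1 == s2 & same_braid b1 b2 || same_up_to_slides n p1 b1 b2].

Definition same_diagram rs a b (f g : tm a b) :=
  [&& simple f, simple g &
    same_word a (normalize rs a (word_of f)) (normalize rs a (word_of g))].

(** * Rewriting rules *)

Definition nat11 (c : tm 2 2) (f : tm 1 1) : seq eqn :=
  [:: Eqn (c ∘ (f ⋄ idH)) ((idH ⋄ f) ∘ c); Eqn (c ∘ (idH ⋄ f)) ((f ⋄ idH) ∘ c)].

Definition nat10 (c : tm 2 2) (f : tm 1 0) : seq eqn :=
  [:: @Eqn 2 1 ((f ⋄ idH) ∘ c) (idH ⋄ f); @Eqn 2 1 ((idH ⋄ f) ∘ c) (f ⋄ idH)].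

(** For c one of the two crossings.  Comultiplications and counits move towards
    the source, all other morphisms towards the target, in accordance with [rank]. *)
Definition nat_rules (c : tm 2 2) : seq eqn :=
  nat11 c SH ++ nat11 c SbarH ++ nat11 c v ++ nat11 c vbar ++ nat10 c ε ++ nat10 c l ++
  [:: @Eqn 3 2 (c ∘ (m ⋄ idH)) ((idH ⋄ m) ∘ (c ⋄ idH) ∘ (idH ⋄ c));
      @Eqn 3 2 (c ∘ (idH ⋄ m)) ((m ⋄ idH) ∘ (idH ⋄ c) ∘ (c ⋄ idH));
      @Eqn 1 2 (c ∘ (η ⋄ idH)) (idH ⋄ η);
      @Eqn 1 2 (c ∘ (idH ⋄ η)) (η ⋄ idH);
      @Eqn 2 3 ((Δ ⋄ idH) ∘ c) ((idH ⋄ c) ∘ (c ⋄ idH) ∘ (idH ⋄ Δ));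
      @Eqn 2 3 ((idH ⋄ Δ) ∘ c) ((c ⋄ idH) ∘ (idH ⋄ c) ∘ (Δ ⋄ idH))].

(** The last two rules create σ and L at the left edge of the diagram. *)
Definition braided_rules : seq eqn :=
  nat_rules γ ++ nat_rules γbar ++
  [:: Eqn (γ ∘ γbar) (Id 2); Eqn (γbar ∘ γ) (Id 2);
      @Eqn 1 3 (idH ⋄ σ) ((γ ⋄ idH) ∘ (idH ⋄ γ) ∘ (σ ⋄ idH));
      @Eqn 1 2 (idH ⋄ L) (γ ∘ (L ⋄ idH))].

Definition bialg_rules : seq eqn :=
  [:: @Eqn 1 3 ((idH ⋄ Δ) ∘ Δ) ((Δ ⋄ idH) ∘ Δ)
    ; @Eqn 1 1 ((ε ⋄ idH) ∘ Δ) idH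
    ; @Eqn 1 1 ((idH ⋄ ε) ∘ Δ) idH
    ; @Eqn 3 1 (m ∘ (idH ⋄ m)) (m ∘ (m ⋄ idH))
    ; @Eqn 1 1 (m ∘ (idH ⋄ η)) idH
    ; @Eqn 1 1 (m ∘ (η ⋄ idH)) idH
    ; @Eqn 2 2 (Δ ∘ m) ((m ⋄ m) ∘ (idH ⋄ γ ⋄ idH) ∘ (Δ ⋄ Δ))
    ; @Eqn 2 0 (ε ∘ m) (ε ⋄ ε)
    ; @Eqn 0 2 (Δ ∘ η) (η ⋄ η)
    ; @Eqn 0 0 (ε ∘ η) (Id 0)
    ; Eqn (SH ∘ SbarH) idH
    ; Eqn (SbarH ∘ SH) idH
    ; Eqn (vbar ∘ v) idH
    ; Eqn (v ∘ vbar) idH ].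

Definition bi_rules := braided_rules ++ bialg_rules.

Definition anti_rules : seq eqn :=
  [:: @Eqn 2 1 (SH ∘ m) (m ∘ (SH ⋄ SH) ∘ γ)
    ; @Eqn 2 1 (SbarH ∘ m) (m ∘ (SbarH ⋄ SbarH) ∘ γbar)
    ; @Eqn 1 2 (Δ ∘ SH) ((SH ⋄ SH) ∘ γ ∘ Δ)
    ; @Eqn 1 2 (Δ ∘ SbarH) ((SbarH ⋄ SbarH) ∘ γbar ∘ Δ)
    ; Eqn (SH ∘ η) η ; Eqn (SbarH ∘ η) η
    ; Eqn (ε ∘ SH) ε ; Eqn (ε ∘ SbarH) ε ].

Definition hopf_rules := bi_rules ++ anti_rules.

Definition ribbon_rules := hopf_rules ++
  [:: @Eqn 1 0 (l ∘ SH) l; @Eqn 1 0 (l ∘ SbarH) l; @Eqn 0 1 (SH ∘ L) L; @Eqn 0 1 (SbarH ∘ L) L;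
      @Eqn 1 0 (ε ∘ v) ε; @Eqn 1 0 (ε ∘ vbar) ε;
      @Eqn 2 1 (m ∘ (v ⋄ idH)) (v ∘ m); @Eqn 2 1 (m ∘ (vbar ⋄ idH)) (vbar ∘ m);
      @Eqn 2 1 (m ∘ (idH ⋄ v)) (v ∘ m); @Eqn 2 1 (m ∘ (idH ⋄ vbar)) (vbar ∘ m);
      Eqn (SH ∘ v) (v ∘ SH); Eqn (SH ∘ vbar) (vbar ∘ SH);
      Eqn (SbarH ∘ v) (v ∘ SbarH); Eqn (SbarH ∘ vbar) (vbar ∘ SbarH)].

(** * Calculus of terms modulo a congruence *)

Section Relation.
Variable E : tm_rel.
Hypothesis EL : braided_congr E.
Notation "f ≡ g" := (E f g) (at level 70).

Definition Etrans a b (f g h : tm a b) : E f g -> E g h -> E f h := @law_trans _ _ EL a b f g h.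
Definition Esym a b (f g : tm a b) : E f g -> E g f := @law_sym _ _ EL a b f g.
Definition Erefl a b (f : tm a b) : E f f := @law_refl _ _ EL a b f.

Lemma comp_congr a b c (f f' : tm b c) (g g' : tm a b) : E f f' -> E g g' ->
  E (f ∘ g) (f' ∘ g').
Proof. exact: (law_comp EL). Qed.

Lemma ten_congr a b c d (f f' : tm a b) (g g' : tm c d) : E f f' -> E g g' ->
  E (f ⋄ g) (f' ⋄ g').
Proof. exact: (law_ten EL). Qed.

Definition interchange a b c a' b' c' (f : tm b c) (g : tm a b) (f' : tm b' c') (g' : tm a' b')
  :
  E ((f ∘ g) ⋄ (f' ∘ g')) ((f ⋄ f') ∘ (g ⋄ g')) :=
  @law_interchange _ _ EL _ _ _ _ _ _ f g f' g'.

Definition compA a b c d (f : tm c d) (g : tm b c) (h : tm a b) :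
  E (f ∘ (g ∘ h)) ((f ∘ g) ∘ h) := @law_compA _ _ EL _ _ _ _ f g h.

Definition compf1 a b (f : tm a b) : E (f ∘ Id a) f := @law_compf1 _ _ EL _ _ f.
Definition comp1f a b (f : tm a b) : E (Id b ∘ f) f := @law_comp1f _ _ EL _ _ f.

Lemma ten_lr a b c d (f : tm a b) (g : tm c d) : E ((Id b ⋄ g) ∘ (f ⋄ Id c)) (f ⋄ g).
Proof.
exact: (Etrans (Esym (interchange (Id b) f g (Id c))) (ten_congr (comp1f f) (compf1 g))).
Qed.

Lemma ten_rl a b c d (f : tm a b) (g : tm c d) : E ((f ⋄ Id d) ∘ (Id a ⋄ g)) (f ⋄ g).
Proof.
exact: (Etrans (Esym (interchange f (Id a) (Id d) g)) (ten_congr (compf1 f) (comp1f g))).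
Qed.

(** Layers of a word live over arities such as (i + src g) + j, which are equal only
    propositionally to those of the terms that they decompose. *)
Definition het a b (f : tm a b) a' b' (g : tm a' b') : Prop :=
  exists (ea : a = a') (eb : b = b'), E (castm ea eb f) g.

Lemma castmE a b (ea : a = a) (eb : b = b) (f : tm a b) : castm ea eb f = f.
Proof. by rewrite (eq_irrelevance ea erefl) (eq_irrelevance eb erefl). Qed.

Lemma E_het a b (f g : tm a b) : E f g -> het f g.
Proof. by move=> e; exists erefl, erefl. Qed.

Lemma het_E a b (f g : tm a b) : het f g -> E f g.
Proof. by case=> ea [eb]; rewrite castmE. Qed.

Lemma het_refl a b (f : tm a b) : het f f. Proof. exact: E_het (Erefl f). Qed.

Lemma het_sym a b (f : tm a b) a' b' (g : tm a' b') : het f g -> het g f.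
Proof. by case=> ea [eb]; subst=> /Esym e; exact: E_het. Qed.

Lemma het_trans a b (f : tm a b) a' b' (g : tm a' b') a'' b'' (h : tm a'' b'') :
  het f g -> het g h -> het f h.
Proof.
case=> ea [eb]; subst=> e [ea [eb]]; subst=> e'; apply: E_het; exact: Etrans e e'.
Qed.

Lemma het_comp a b c (f : tm b c) (g : tm a b) a' b' c' (f' : tm b' c') (g' : tm a' b') :
  het f f' -> het g g' -> het (f ∘ g) (f' ∘ g').
Proof.
case=> ea [eb]; subst=> e [ea [eb]]; subst; rewrite castmE => e'; apply: E_het.
exact: comp_congr.
Qed.

Lemma het_ten a b c d (f : tm a b) (g : tm c d) a' b' c' d' (f' : tm a' b') (g' : tm c' d') :
  het f f' -> het g g' -> het (f ⋄ g) (f' ⋄ g').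
Proof.
case=> ea [eb]; subst=> e [ea [eb]]; subst=> e'; apply: E_het; exact: ten_congr.
Qed.

Lemma het_castm a b a' b' (ea : a = a') (eb : b = b') (f : tm a b) : het (castm ea eb f) f.
Proof. by subst; exact: het_refl. Qed.

Lemma het_tenA a b c a' b' c' (f : tm a a') (g : tm b b') (h : tm c c') :
  het (f ⋄ (g ⋄ h)) ((f ⋄ g) ⋄ h).
Proof. exists (addnA a b c), (addnA a' b' c'); exact: (law_tenA EL). Qed.

Lemma het_ten1f a b (f : tm a b) : het (Id 0 ⋄ f) f.
Proof. exists (add0n a), (add0n b); exact: (law_ten1f EL). Qed.

Lemma het_tenf1 a b (f : tm a b) : het (f ⋄ Id 0) f.
Proof. exists (addn0 a), (addn0 b); exact: (law_tenf1 EL). Qed.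

Lemma het_id a b : het (Id a ⋄ Id b) (Id (a + b)).
Proof. exact: E_het (@law_ten_id _ _ EL a b). Qed.

Lemma het_Id a b : a = b -> het (Id a) (Id b).
Proof. by move=> ->; exact: het_refl. Qed.

Lemma het_dims a b (f : tm a b) a' b' (g : tm a' b') : het f g -> a = a' /\ b = b'.
Proof. by case=> ? []. Qed.

(** * Denotation of words *)

(** A relation, since a word does not record its width to the right of the
    layers; by [denotes_inj] it is single-valued. *)
Fixpoint denotes (w : word) n b (f : tm n b) : Prop := match w with
  | [::] => het f (Id n)
  | (i, g) :: w' => exists j b' (f' : tm (i + tgt g + j) b'),
     [/\ n = i + src g + j, denotes w' f' & het f (f' ∘ (Id i ⋄ term_of_gen g ⋄ Id j))]
  end.

Lemma denotes_het w n b (f : tm n b) n' b' (f' : tm n' b') : het f f' -> denotes w f ->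
  denotes w f'.
Proof.
case: w => [|[i g] w] /= h; case: (h) => en [eb _]; subst.
  by move=> s; apply: het_trans (het_sym h) s.
case=> j [b'' [f'' [e s e']]]; exists j, b'', f''; split=> //.
exact: het_trans (het_sym h) e'.
Qed.

Lemma denotes_inj w n b (f : tm n b) b' (f' : tm n b') : denotes w f -> denotes w f' ->
  het f f'.
Proof.
elim: w n b f b' f' => [|[i g] w IH] n b f b' f' /=.
  by move=> h h'; apply: het_trans h (het_sym h').
case=> j [c [h [en s e]]] [j' [c' [h' [en' s' e']]]].
have ej : j = j' by lia.
subst j'; apply: het_trans e (het_trans _ (het_sym e')).
by apply: het_comp (het_refl _); exact: IH s s'.
Qed.

Lemma denotes_cat w1 w2 n b (f : tm n b) : denotes (w1 ++ w2) f <->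
  exists k (f1 : tm n k) (f2 : tm k b), [/\ denotes w1 f1, denotes w2 f2 & E f (f2 ∘ f1)].
Proof.
elim: w1 n b f => [|[i g] w1 IH] n b f /=.
  split=> [s|[k [f1 [f2 [h s e]]]]].
    by exists n, (Id n), f; split=> //; [exact: het_refl | exact: Esym (compf1 f)].
  have [_ ek] := het_dims h; subst k.
  by apply: denotes_het s; apply: E_het; apply: Esym;
      apply: Etrans e (Etrans (comp_congr (Erefl f2) (het_E h)) (compf1 f2)).
split.
- case=> j [b' [f' [en s h]]]; have [_ eb] := het_dims h; subst.
  have [k [f1 [f2 [s1 s2 e]]]] := (IH _ _ _).1 s.
  exists k, (f1 ∘ (Id i ⋄ term_of_gen g ⋄ Id j)), f2; split=> //.
    by exists j, k, f1; split=> //; exact: het_refl.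
  apply: Etrans (het_E h) _; apply: Etrans (comp_congr e (Erefl _)) _;
    exact: Esym (compA _ _ _).
- case=> k [f1 [f2 [[j [b' [f' [en s h]]]] s2 e]]].
  have [_ eb] := het_dims h; subst.
  exists j, b, (f2 ∘ f'); split=> //.
    by apply/IH; exists b', f', f2; split=> //; exact: Erefl.
  apply: E_het; apply: Etrans e _; apply: Etrans (comp_congr (Erefl _) (het_E h)) _;
    exact: compA.
Qed.

Lemma denotes_comp w1 w2 n k b (f1 : tm n k) (f2 : tm k b) : denotes w1 f1 -> denotes w2 f2 ->
  denotes (w1 ++ w2) (f2 ∘ f1).
Proof. by move=> s1 s2; apply/denotes_cat; exists k, f1, f2; split=> //; exact: Erefl. Qed.

Lemma shift0 w : shift 0 w = w.
Proof. by rewrite /shift; elim: w => //= [[i g] w ->]. Qed.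

Lemma denotes_shift i j w n b (f : tm n b) : denotes w f ->
  denotes (shift i w) (Id i ⋄ f ⋄ Id j).
Proof.
elim: w n b f => [|[k g] w IH] n b f /=.
  move=> h; have [_ eb] := het_dims h; subst.
  apply: het_trans (het_ten (het_ten (het_refl _) h) (het_refl _)) _.
  by apply: het_trans (het_ten (het_id _ _) (het_refl _)) (het_id _ _).
case=> j' [b' [f' [en s h]]]; have [_ eb] := het_dims h; subst.
have en : i + (k + tgt g + j') + j = i + k + tgt g + (j' + j) by lia.
have em : i + (k + src g + j') + j = i + k + src g + (j' + j) by lia.
exists (j' + j), (i + b' + j), (castm en erefl (Id i ⋄ f' ⋄ Id j)); split=> //.
  by apply: denotes_het (IH _ _ _ s); apply: het_sym; exact: het_castm.
apply: het_trans (het_ten (het_ten (het_refl _) h) (het_refl _)) _.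
have e1 : E (Id i ⋄ (f' ∘ (Id k ⋄ term_of_gen g ⋄ Id j')) ⋄ Id j)
            ((Id i ⋄ f' ⋄ Id j) ∘ (Id i ⋄ (Id k ⋄ term_of_gen g ⋄ Id j') ⋄ Id j)).
  apply: Etrans (ten_congr (Etrans (ten_congr (Esym (comp1f (Id i))) (Erefl _))
    (interchange (Id i) (Id i) f' _)) (Esym (comp1f (Id j)))) _.
  exact: interchange.
apply: het_trans (E_het e1) _; apply: het_comp.
  by apply: het_sym; exact: het_castm.
apply: het_trans (het_ten (het_tenA _ _ _) (het_refl _)) _.
apply: het_trans (het_sym (het_tenA _ _ _)) _.
apply: het_ten (het_id _ _).
apply: het_trans (het_tenA _ _ _) _.
exact: het_ten (het_id _ _) (het_refl _).
Qed.

Lemma denotes_word_of a b (f : tm a b) : simple f -> denotes (word_of f) f.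
Proof.
elim: f => {a b} [a b e|a|a b c f IHf g IHg|a b c d f IHf g IHg|a b|a b] /=.
- move=> _; case: e => /=; exists 0; eexists; eexists; split; try exact: het_refl; try done;
  (apply: het_sym; apply: het_trans (E_het (comp1f _)) _;
   apply: het_trans (het_tenf1 _) (het_ten1f _)).
- by move=> _; exact: het_refl.
- by case/andP=> sf sg; apply: denotes_comp; [exact: IHg | exact: IHf].
- case/andP=> sf sg.
  apply: (@denotes_het _ _ _ ((Id b ⋄ g) ∘ (f ⋄ Id c))); first exact: E_het (ten_lr f g).
  apply: denotes_comp.
    rewrite -(shift0 (word_of f)); apply: denotes_het (denotes_shift 0 c (IHf sf)).
    by apply: het_ten (het_ten1f _) (het_refl _).
  by apply: denotes_het (denotes_shift b 0 (IHg sg)); exact: het_tenf1.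
- case/andP=> /eqP -> /eqP ->; exists 0; eexists; eexists; split; try exact: het_refl; try done.
  apply: het_sym; apply: het_trans (E_het (comp1f _)) _;
   apply: het_trans (het_tenf1 _) (het_ten1f _).
- case/andP=> /eqP -> /eqP ->; exists 0; eexists; eexists; split; try exact: het_refl; try done.
  apply: het_sym; apply: het_trans (E_het (comp1f _)) _;
   apply: het_trans (het_tenf1 _) (het_ten1f _).
Qed.

(** * Soundness of rewriting *)

(** One-sided, so that nothing has to be said about words that denote no
    morphism out of n strands. *)
Definition refines n (w w' : word) := forall b (f : tm n b), denotes w f -> denotes w' f.

Lemma refines_catr n w w' s : refines n w w' -> refines n (w ++ s) (w' ++ s).
Proof.
move=> h b f /denotes_cat[k [f1 [f2 [s1 s2 e]]]].
by apply/denotes_cat; exists k, f1, f2; split=> //; exact: h.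
Qed.

Lemma refines_cons n (x : layer) w w' :
  (src x.2 <= n -> refines (n - src x.2 + tgt x.2) w w') -> refines n (x :: w) (x :: w').
Proof.
case: x => i g /= h b f [j [b' [f' [en s e]]]]; exists j, b', f'; split=> //.
have hn : n - src g + tgt g = i + tgt g + j by lia.
by move: h; rewrite hn => h; apply: h s; lia.
Qed.

Definition sound_rule (r : eqn) := [/\ simple (elhs r), simple (erhs r) & E (elhs r) (erhs r)].
Fixpoint sound rs := if rs is r :: rs' then sound_rule r /\ sound rs' else True.

Lemma refines_rule n i (r : eqn) : sound_rule r -> i + esrc r <= n ->
  refines n (shift i (word_of (elhs r))) (shift i (word_of (erhs r))).
Proof.
case=> sl sr e le b f s.
have en : n = i + esrc r + (n - (i + esrc r)) by lia.
move: (n - _) en => j en; subst n.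
have h := denotes_inj s (denotes_shift i j (denotes_word_of sl)).
apply: denotes_het (het_sym h) _.
apply: denotes_het (denotes_shift i j (denotes_word_of sr)).
by apply: E_het; apply: ten_congr (Erefl _); apply: ten_congr (Erefl _) _; exact: Esym.
Qed.

Lemma denotes_exchange a g b h c :
  let f := Id a ⋄ term_of_gen g ⋄ Id b ⋄ term_of_gen h ⋄ Id c in
  denotes [:: (a, g); (a + tgt g + b, h)] f /\ denotes [:: (a + src g + b, h); (a, g)] f.
Proof.
move=> f; split.
- have en : a + tgt g + (b + src h + c) = a + tgt g + b + src h + c by lia.
  exists (b + src h + c), _, (castm (esym en) erefl
  (Id (a + tgt g + b) ⋄ term_of_gen h ⋄ Id c)).
  split; first lia.
    exists c, _, (Id (a + tgt g + b + tgt h + c)); split=> //; first exact: het_refl.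
    by apply: het_trans (het_castm _ _ _) (het_sym (E_het (comp1f _))).
  have e : E f ((Id (a + tgt g + b) ⋄ term_of_gen h ⋄ Id c) ∘
    (Id a ⋄ term_of_gen g ⋄ Id b ⋄ Id (src h) ⋄ Id c)).
    apply: Etrans (ten_congr (Esym (ten_lr _ _)) (Esym (comp1f _))) _.
    apply: Etrans (interchange _ _ _ _) _; apply: comp_congr (Erefl _).
    exact: ten_congr (Erefl _) (Erefl _).
  apply: het_trans (E_het e) _; apply: het_comp; first exact: het_sym (het_castm _ _ _).
  apply: het_trans (het_sym (het_tenA _ _ _)) _.
  apply: het_trans (het_ten (het_refl _) (het_id _ _)) _.
  apply: het_trans (het_sym (het_tenA _ _ _)) _.
  apply: het_ten (het_refl _) _.
  by apply: het_trans (het_id _ _) (het_Id _); lia.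
- have en : a + src g + (b + tgt h + c) = a + src g + b + tgt h + c by lia.
  exists c, _, (castm en erefl (Id a ⋄ term_of_gen g ⋄ Id (b + tgt h + c))).
  split=> //.
    exists (b + tgt h + c), _, (Id (a + tgt g + (b + tgt h + c))); split=> //;
    first exact: het_refl.
    by apply: het_trans (het_castm _ _ _) (het_sym (E_het (comp1f _))).
  have e : E f ((Id a ⋄ term_of_gen g ⋄ Id b ⋄ Id (tgt h) ⋄ Id c) ∘
    (Id (a + src g + b) ⋄ term_of_gen h ⋄ Id c)).
    apply: Etrans (ten_congr (Esym (ten_rl _ _)) (Esym (comp1f _))) _.
    exact: interchange.
  apply: het_trans (E_het e) _; apply: het_comp (het_refl _).
  apply: het_sym; apply: het_trans (het_castm _ _ _) _; apply: het_sym.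
  apply: het_trans (het_sym (het_tenA _ _ _)) _.
  apply: het_trans (het_ten (het_refl _) (het_id _ _)) _.
  apply: het_trans (het_sym (het_tenA _ _ _)) _.
  apply: het_ten (het_refl _) _.
  by apply: het_trans (het_id _ _) (het_Id _); lia.
Qed.

Lemma refines_of_denotes n w w' b (f : tm n b) : denotes w f -> denotes w' f -> refines n w w'.
Proof. by move=> s s' b' f' t; apply: denotes_het s'; exact: denotes_inj s t. Qed.

Lemma refines_swap_left n i g j h : j + src h <= i ->
  refines n [:: (i, g); (j, h)] [:: (j, h); (i - src h + tgt h, g)].
Proof.
move=> le b f s; have [j1 [_ [_ [en _ _]]]] := s.
have ei : i = j + src h + (i - (j + src h)) by lia.
move: (i - (j + src h)) ei => d ei; subst i n.
have [s1 s2] := denotes_exchange j h d g j1.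
have -> : j + src h + d - src h + tgt h = j + tgt h + d by lia.
exact: (refines_of_denotes s2 s1) s.
Qed.

Lemma refines_swap_right n i g j h : i + tgt g <= j ->
  refines n [:: (i, g); (j, h)] [:: (j - tgt g + src g, h); (i, g)].
Proof.
move=> le b f s; have [j1 [_ [_ [en [c [_ [_ [en' _ _]]]] _]]]] := s.
have ej : j = i + tgt g + (j - (i + tgt g)) by lia.
move: (j - (i + tgt g)) ej => d ej; subst j.
have ej1 : j1 = d + src h + c by lia.
have en2 : n = i + src g + d + src h + c by lia.
clear en; subst n.
have [s1 s2] := denotes_exchange i g d h c.
have -> : i + tgt g + d - tgt g + src g = i + src g + d by lia.
exact: (refines_of_denotes s1 s2) s.
Qed.

Lemma refines_swap before n w w' : swap_head before w = Some w' -> refines n w w'.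
Proof.
case: w => [|[i g] [|[j h] s]] //=; case: ifP => // _.
case: ifP => [le [<-]|_].
  exact: (@refines_catr n [:: (i, g); (j, h)] [:: _; _] s (refines_swap_left le)).
case: ifP => [le [<-]|//].
exact: (@refines_catr n [:: (i, g); (j, h)] [:: _; _] s (refines_swap_right le)).
Qed.

Lemma refines_rewrite_head n w w' r : sound_rule r -> rewrite_head n w r = Some w' ->
  refines n w w'.
Proof.
move=> sr; rewrite /rewrite_head.
have H i : i + esrc r <= n -> refines n (shift i (word_of (elhs r)))
  (shift i (word_of (erhs r))).
  exact: refines_rule.
case: (word_of (elhs r)) H => [|[i0 g0] l] // H.
case: w => [|[i1 g1] s] //; case: ifP => // /and3P[_ /prefixP[t ->] le] [<-].
have -> : drop (size l) (shift (i1 - i0) l ++ t) = t.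
  by rewrite drop_size_cat ?size_map.
by apply: refines_catr; exact: H.
Qed.

Lemma refines_rewrite_head_any n w w' rs : sound rs -> rewrite_head_any n w rs = Some w' ->
  refines n w w'.
Proof.
elim: rs => //= r rs IH [sr srs]; case E1 : (rewrite_head n w r) => [w1|]; last exact: IH.
by case=> <-; exact: refines_rewrite_head E1.
Qed.

Lemma refines_step before n w w' rs : sound rs -> rewrite_step before rs n w = Some w' ->
  refines n w w'.
Proof.
move=> srs; rewrite /rewrite_step; case E1 : (swap_head before w) => [w1|];
  last exact: refines_rewrite_head_any.
by case=> <-; exact: refines_swap E1.
Qed.

Fixpoint prefix_width n0 (pre : seq (nat * layer)) n := match pre with
  | [::] => n = n0
  | (k, x) :: p => n = k - src x.2 + tgt x.2 /\ prefix_width n0 p k end.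

Lemma refines_prefix n0 pre n w w' : prefix_width n0 pre n -> refines n w w' ->
  refines n0 (catrev (map snd pre) w) (catrev (map snd pre) w').
Proof.
elim: pre n w w' => [|[k x] p IH] n w w' /=; first by move=> ->.
by case=> -> hp h; apply: IH hp _; apply: refines_cons.
Qed.

Lemma refines_loop before rs fuel n0 pre n w : sound rs -> prefix_width n0 pre n ->
  refines n0 (catrev (map snd pre) w) (rewrite_loop before rs fuel pre n w).
Proof.
move=> srs; elim: fuel pre n w => [|fuel IH] pre n w hp //=; case: w => [|x s] //.
case E1 : (rewrite_step before rs n (x :: s)) => [w'|]; last first.
  exact: (IH ((n, x) :: pre)).
have h := refines_prefix hp (refines_step srs E1).
case: pre hp h => [|[k y] [|[k' z] p]] hp h b f /h h'.
- exact: (IH [::] n w' hp) h'.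
- by case: hp => _ ek; exact: (IH [::] k (y :: w') ek) h'.
- by case: hp => _ [_ hp]; exact: (IH p k' (z :: y :: w') hp) h'.
Qed.

Lemma refines_normalize rs n w : sound rs -> refines n w (normalize rs n w).
Proof.
move=> srs; rewrite /normalize; move: fuel => k; exact:
  (@refines_loop moves_before rs k n [::] n w srs (erefl n)).
Qed.

(** * Relations between crossings *)

(** Inverting c1 and c2 in a commuting square exchanges its sides. *)
Lemma intertwine_inv a b c d (A : tm a b) (B : tm c d) (c1 : tm a c) (c1' : tm c a)
  (c2 : tm b d) (c2' : tm d b) :
  c2' ∘ c2 ≡ Id b -> c1 ∘ c1' ≡ Id c -> c2 ∘ A ≡ B ∘ c1 -> c2' ∘ B ≡ A ∘ c1'.
Proof.
move=> k2 k1 h.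
apply: Etrans (comp_congr (Erefl c2') (Etrans (Esym (compf1 B))
  (comp_congr (Erefl B) (Esym k1)))) _.
apply: Etrans (comp_congr (Erefl c2') (Etrans (compA B c1 c1')
  (comp_congr (Esym h) (Erefl c1')))) _.
apply: Etrans (comp_congr (Erefl c2') (Esym (compA c2 A c1'))) _.
by apply: Etrans (compA _ _ _) _; apply: Etrans (comp_congr k2 (Erefl _)) _; exact: comp1f.
Qed.

Lemma comp_moveL a b c (A : tm a b) (B : tm a c) (c1 : tm b c) (c1' : tm c b) :
  c1' ∘ c1 ≡ Id b -> c1 ∘ A ≡ B -> c1' ∘ B ≡ A.
Proof.
move=> k1 h; apply: Etrans (comp_congr (Erefl c1') (Esym h)) _; apply: Etrans (compA _ _ _) _.
by apply: Etrans (comp_congr k1 (Erefl A)) _; exact: comp1f.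
Qed.

Lemma comp_moveR a b c (A : tm a b) (B : tm c b) (c1 : tm a c) (c1' : tm c a) :
  c1 ∘ c1' ≡ Id c -> A ≡ B ∘ c1 -> A ∘ c1' ≡ B.
Proof.
move=> k1 h; apply: Etrans (comp_congr h (Erefl c1')) _; apply: Etrans (Esym (compA _ _ _)) _.
by apply: Etrans (comp_congr (Erefl B) k1) _; exact: compf1.
Qed.

Lemma γK : γbar ∘ γ ≡ Id 2. Proof. exact: (@law_braidK tm_ops E EL 1 1). Qed.
Lemma γbarK : γ ∘ γbar ≡ Id 2. Proof. exact: (@law_ibraidK tm_ops E EL 1 1). Qed.

Lemma braid_nat a b a' b' (f : tm a a') (g : tm b b') :
  (g ⋄ f) ∘ Braid a b ≡ Braid a' b' ∘ (f ⋄ g).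
Proof. exact: (law_braid_nat EL). Qed.

Lemma braid12 : Braid 1 2 ≡ (idH ⋄ γ) ∘ (γ ⋄ idH).
Proof. by have := @law_hexagon_r _ _ EL 1 1 1; rewrite !castmE. Qed.

Lemma braid21 : Braid 2 1 ≡ (γ ⋄ idH) ∘ (idH ⋄ γ).
Proof. by have := @law_hexagon_l _ _ EL 1 1 1; rewrite !castmE. Qed.

Lemma idem_id (f g : tm 1 1) : g ∘ f ≡ Id 1 -> f ≡ f ∘ f -> f ≡ Id 1.
Proof.
move=> k h; apply: Etrans (Esym (comp1f f)) _; apply: Etrans (comp_congr (Esym k) (Erefl f)) _.
by apply: Etrans (Esym (compA g f f)) _; apply: Etrans (comp_congr (Erefl g) (Esym h)) k.
Qed.

(** The hexagon for 1, 0, 0 makes this invertible morphism idempotent. *)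
Lemma braid10 : Braid 1 0 ≡ Id 1.
Proof.
apply: (@idem_id (Braid 1 0) (Ibraid 1 0)); first exact: (@law_braidK tm_ops E EL 1 0).
have := @law_hexagon_r _ _ EL 1 0 0; rewrite !castmE => h.
apply: Etrans h _; apply: comp_congr.
  by have := @law_ten1f _ _ EL 1 1 (Braid 1 0); rewrite castmE.
by have := @law_tenf1 _ _ EL 1 1 (Braid 1 0); rewrite castmE.
Qed.

Lemma braid01 : Braid 0 1 ≡ Id 1.
Proof.
apply: (@idem_id (Braid 0 1) (Ibraid 0 1)); first exact: (@law_braidK tm_ops E EL 0 1).
have := @law_hexagon_l _ _ EL 0 0 1; rewrite !castmE => h.
apply: Etrans h _; apply: comp_congr.
  by have := @law_tenf1 _ _ EL 1 1 (Braid 0 1); rewrite castmE.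
by have := @law_ten1f _ _ EL 1 1 (Braid 0 1); rewrite castmE.
Qed.

Lemma ten_inv_l (c c' : tm 2 2) : c' ∘ c ≡ Id 2 -> (c' ⋄ idH) ∘ (c ⋄ idH) ≡ Id 3.
Proof.
move=> k; apply: Etrans (Esym (interchange c' c idH idH)) _.
by apply: Etrans (ten_congr k (comp1f idH)) _; exact: (@law_ten_id _ _ EL 2 1).
Qed.

Lemma ten_inv_r (c c' : tm 2 2) : c' ∘ c ≡ Id 2 -> (idH ⋄ c') ∘ (idH ⋄ c) ≡ Id 3.
Proof.
move=> k; apply: Etrans (Esym (interchange idH idH c' c)) _.
by apply: Etrans (ten_congr (comp1f idH) k) _; exact: (@law_ten_id _ _ EL 1 2).
Qed.

Lemma comp_inv (c c' d d' : tm 3 3) : c' ∘ c ≡ Id 3 -> d' ∘ d ≡ Id 3 ->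
  (c' ∘ d') ∘ (d ∘ c) ≡ Id 3.
Proof.
move=> kc kd; apply: Etrans (compA _ _ _) _; apply: Etrans _ kc; apply: comp_congr (Erefl c).
apply: Etrans (Esym (compA _ _ _)) _; apply: Etrans (comp_congr (Erefl c') kd) _; exact: compf1.
Qed.

Lemma crossingK e : crossing (~~ e) ∘ crossing e ≡ Id 2.
Proof. by case: e; [exact: γK | exact: γbarK]. Qed.

Lemma yang_baxter :
  (γ ⋄ idH) ∘ ((idH ⋄ γ) ∘ (γ ⋄ idH)) ≡ ((idH ⋄ γ) ∘ (γ ⋄ idH)) ∘ (idH ⋄ γ).
Proof.
apply: Etrans (comp_congr (Erefl _) (Esym braid12)) _;
  apply: Etrans _ (comp_congr braid12 (Erefl _)).
exact: (@braid_nat 1 2 1 2 idH γ).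
Qed.

(** A crossing of either sign slides along a strand that lies over both of its
    strands, by naturality of the braiding. *)
Lemma pass_over d :
  (crossing d ⋄ idH) ∘ ((idH ⋄ γ) ∘ (γ ⋄ idH)) ≡ ((idH ⋄ γ) ∘ (γ ⋄ idH)) ∘ (idH ⋄ crossing d).
Proof.
case: d; first exact: yang_baxter.
exact: (intertwine_inv (ten_inv_l γK) (ten_inv_r γbarK) yang_baxter).
Qed.

Lemma yang_baxter' :
  (idH ⋄ γ) ∘ ((γ ⋄ idH) ∘ (idH ⋄ γ)) ≡ ((γ ⋄ idH) ∘ (idH ⋄ γ)) ∘ (γ ⋄ idH).
Proof.
apply: Etrans (compA _ _ _) _; apply: Etrans (Esym yang_baxter) _; exact: compA.
Qed.

Lemma pass_under d :
  (idH ⋄ crossing d) ∘ ((γ ⋄ idH) ∘ (idH ⋄ γ)) ≡ ((γ ⋄ idH) ∘ (idH ⋄ γ)) ∘ (crossing d ⋄ idH).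
Proof.
case: d; first exact: yang_baxter'.
exact: (intertwine_inv (ten_inv_r γK) (ten_inv_l γbarK) yang_baxter').
Qed.

(** This is [pass_over] or [pass_under] with one crossing carried to the other side. *)
Lemma pass_sound e d : sound_rule (pass_rule e d).
Proof.
split; [by case: e; case: d | by case: e; case: d | ].
rewrite /=; apply: Esym; apply: (@comp_moveR _ _ _ _ _ (idH ⋄ crossing e)).
  by apply: ten_inv_r; have := crossingK (~~ e); rewrite negbK.
case: e; last first.
  apply: Etrans _ (compA _ _ _); apply: (intertwine_inv _ _ (Esym (pass_over d))).
    exact: comp_inv (ten_inv_l γK) (ten_inv_r γK).
  exact: comp_inv (ten_inv_r γbarK) (ten_inv_l γbarK).
by apply: Etrans (Esym (pass_under d)) _; exact: compA.
Qed.

Lemma cancel_sound e : sound_rule (cancel_rule e).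
Proof. by case: e; split=> //; [exact: γK | exact: γbarK]. Qed.

Lemma birth_sound : sound birth_rules.
Proof.
have birth_l : (γ ⋄ idH) ∘ (idH ⋄ γ) ∘ (σ ⋄ idH) ≡ idH ⋄ σ.
  apply: Etrans (comp_congr (Esym braid21) (Erefl _)) _.
  apply: Etrans (Esym (@braid_nat 0 1 2 1 σ idH)) _.
  by apply: Etrans (comp_congr (Erefl _) braid01) _; exact: compf1.
have birth_r : (idH ⋄ γ) ∘ (γ ⋄ idH) ∘ (idH ⋄ σ) ≡ σ ⋄ idH.
  apply: Etrans (comp_congr (Esym braid12) (Erefl _)) _.
  apply: Etrans (Esym (@braid_nat 1 0 1 2 idH σ)) _.
  by apply: Etrans (comp_congr (Erefl _) braid10) _; exact: compf1.
have birth_l' : (γbar ⋄ idH) ∘ (idH ⋄ γbar) ∘ (σ ⋄ idH) ≡ idH ⋄ σ.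
  exact: (comp_moveL (A := idH ⋄ σ) (B := σ ⋄ idH) (comp_inv (ten_inv_l γK) (ten_inv_r γK))
    birth_r).
have birth_r' : (idH ⋄ γbar) ∘ (γbar ⋄ idH) ∘ (idH ⋄ σ) ≡ σ ⋄ idH.
  exact: (comp_moveL (A := σ ⋄ idH) (B := idH ⋄ σ) (comp_inv (ten_inv_r γK) (ten_inv_l γK))
    birth_l).
by do 4!split=> //.
Qed.

(** * Soundness of handle reduction *)

Definition braid_word (b : seq letter) : word := map layer_of b.
Definition refines_all w w' := forall n, refines n w w'.

Lemma refines_all_trans w w' w'' : refines_all w w' -> refines_all w' w'' -> refines_all w w''.
Proof. by move=> h h2 n b f s; apply: h2; exact: h. Qed.

Lemma refines_all_catl p w w' : refines_all w w' -> refines_all (p ++ w) (p ++ w').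
Proof. by move=> h; elim: p => [|x p IH] n //=; apply: refines_cons => _; exact: IH. Qed.

Lemma refines_cancel k e s : refines_all (braid_word ((k, e) :: (k, ~~ e) :: s)) (braid_word s).
Proof.
move=> n b f hs; have [j [_ [_ [en _ _]]]] := hs.
apply: (@refines_catr _ (shift k (word_of (elhs (cancel_rule e)))) [::] (braid_word s) _ b f).
  by apply: refines_rule (cancel_sound e) _ => /=; move: en; case: (e) => /=; lia.
by move: hs; case: (e); rewrite /= !addn0.
Qed.

Lemma refines_pass k e d s :
  refines_all (braid_word ((k, e) :: (k.+1, d) :: s))
    (braid_word ((k.+1, ~~ e) :: (k, d) :: (k.+1, e) :: (k, e) :: s)).
Proof.
move=> n b f hs; have [j [_ [_ [en [j' [_ [_ [en' _ _]]]] _]]]] := hs.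
have hn : k + 3 <= n by move: en en'; case: (e); case: (d) => /=; lia.
have h := @refines_catr n _ _ (braid_word s) (refines_rule (pass_sound e d) hn).
have {h}h := h b f.
move: hs h; rewrite /braid_word /= /layer_of /=.
by case: (e); case: (d); rewrite /= !addn0 !addn1 => hs h; exact: h.
Qed.

Lemma refines_far k e i d s : i != k -> i.+1 != k -> i != k.+1 ->
  refines_all (braid_word ((k, e) :: (i, d) :: s)) (braid_word ((i, d) :: (k, e) :: s)).
Proof.
move=> h1 h2 h3 n.
have gX2 x : src (crossing_gen x) = 2 /\ tgt (crossing_gen x) = 2 by case: x.
have [se te] := gX2 e; have [sd td] := gX2 d.
rewrite /braid_word /= /layer_of /=.
have [le|gt] := leqP (i + 2) k.
  have hw := @refines_swap_left n k (crossing_gen e) i (crossing_gen d).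
  rewrite sd td in hw; have := hw le; have -> : k - 2 + 2 = k by lia.
  by move=> h; exact: (@refines_catr n [:: _; _] [:: _; _] (braid_word s) h).
have hw := @refines_swap_right n k (crossing_gen e) i (crossing_gen d).
rewrite te se in hw; have le : k + 2 <= i by lia.
have := hw le; have -> : i - 2 + 2 = i by lia.
by move=> h; exact: (@refines_catr n [:: _; _] [:: _; _] (braid_word s) h).
Qed.

(** By induction on v: the first letter of the handle commutes with distant
    letters and passes c(k+1) by [pass_rule]. *)
Lemma refines_unhook k e v s : all (fun x : letter => (x.1 != k) && (x.1.+1 != k)) v ->
  refines_all (braid_word ((k, e) :: v ++ (k, ~~ e) :: s)) (braid_word (unhook k e v ++ s)).
Proof.
elim: v => [_|[i d] v IH /= /andP[/andP[h1 h2] hv]]; first exact: refines_cancel.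
rewrite /unhook /=; case: eqVneq => [->|h3] /=.
  refine (refines_all_trans (@refines_pass k e d (v ++ (k, ~~ e) :: s)) _).
  by move=> n; do 3!(apply: refines_cons => _); exact: IH.
refine (refines_all_trans (@refines_far k e i d (v ++ (k, ~~ e) :: s) h1 h2 h3) _).
by move=> n; apply: refines_cons => _; exact: IH.
Qed.

Lemma find_handleP k e pre v p v' rest : find_handle k e pre v = Some (p, v') ->
  all (fun x : letter => (x.1 != k) && (x.1.+1 != k)) v ->
  catrev pre (v ++ rest) = catrev p ((k, ~~ e) :: v' ++ rest) /\
  all (fun x : letter => (x.1 != k) && (x.1.+1 != k)) v'.
Proof.
elim: pre v => [|[i d] pre IH] v //=; case: eqVneq => [->|h1].
  by case: eqVneq => // -> [<- <-] hv.
case: eqVneq => // h2 /IH h hv; apply: h; by rewrite /= h1 h2.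
Qed.

Lemma braid_word_catrev pre s : braid_word (catrev pre s) = braid_word (rev pre) ++ braid_word
  s.
Proof. by rewrite catrevE /braid_word map_cat. Qed.

Lemma refines_reduce_handles fuel pre s : refines_all (braid_word (catrev pre s))
  (braid_word (reduce_handles fuel pre s)).
Proof.
elim: fuel pre s => [|fuel IH] pre s /=; first by move=> n b f.
case: s => [|[k e] s] /=; first by move=> n b f.
case E1 : (find_handle k e pre [::]) => [[p v]|]; last exact: (IH ((k, e) :: pre)).
have [-> hv] := find_handleP ((k, e) :: s) E1 isT.
apply: refines_all_trans (IH _ _).
have := @refines_unhook k (~~ e) v s hv; rewrite negbK => hc.
rewrite (braid_word_catrev p ((k, ~~ e) :: v ++ (k, e) :: s))
  (braid_word_catrev p (unhook k (~~ e) v ++ s)).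
exact: refines_all_catl.
Qed.

Lemma refines_braid_reduce b : refines_all (braid_word b) (braid_word (braid_reduce b)).
Proof. rewrite /braid_reduce; move: fuel => k; exact: (@refines_reduce_handles k [::] b). Qed.

Definition fits n (b : braid) := all (fun x : letter => x.1.+1 < n) b.

Lemma denotes_fits n k (b : braid) (f : tm n k) : denotes (braid_word b) f -> fits n b /\ k = n.
Proof.
elim: b n f => [|[i e] b IH] n f /=; first by move=> /het_dims[_ ->].
case=> j [k' [f' [en s h]]]; have [_ ek] := het_dims h; subst k'.
have -> : n = i + tgt (crossing_gen e) + j by rewrite en; case: (e).
have [hb ek] := IH _ _ s; split=> //.
by rewrite hb andbT; case: (e) => /=; lia.
Qed.

Lemma fits_denotes n (b : braid) : fits n b -> exists f : tm n n, denotes (braid_word b) f.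
Proof.
elim: b => [|[i e] b IH] /=; first by exists (Id n); exact: het_refl.
case/andP=> le /IH[f s].
have en : n = i + src (crossing_gen e) + (n - (i + 2)) by case: (e) => /=; lia.
have en' : n = i + tgt (crossing_gen e) + (n - (i + 2)) by case: (e) => /=; lia.
exists (castm (esym en) erefl (castm en' erefl f ∘
  (Id i ⋄ term_of_gen (crossing_gen e) ⋄ Id (n - (i + 2))))).
exists (n - (i + 2)), n, (castm en' erefl f); split=> //.
  by apply: denotes_het s; exact: het_sym (het_castm _ _ _).
exact: het_castm.
Qed.

Lemma fits_inv n b : fits n (inv_braid b) = fits n b.
Proof. by rewrite /fits /inv_braid all_rev all_map. Qed.

Lemma refines_inv_braid b : refines_all (braid_word (inv_braid b ++ b)) [::].
Proof.
elim: b => [|[k e] b IH]; first by move=> n b f.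
rewrite /inv_braid /= rev_cons cat_rcons.
apply: refines_all_trans IH.
have := @refines_cancel k (~~ e) b; rewrite negbK => h.
by rewrite /braid_word !map_cat; exact: refines_all_catl.
Qed.

(** Since b1 b2^-1 reduces to the empty word, its denotation is the identity; a
    morphism denoted by b2^-1 exists and is inverse to the one denoted by b2. *)
Lemma same_braidP n b1 b2 (f1 f2 : tm n n) :
  same_braid b1 b2 -> denotes (braid_word b1) f1 -> denotes (braid_word b2) f2 -> E f1 f2.
Proof.
move=> /eqP h s1 s2.
have [g sg] : exists g : tm n n, denotes (braid_word (inv_braid b2)) g.
  by apply: fits_denotes; rewrite fits_inv; case: (denotes_fits s2).
have e1 : E (g ∘ f1) (Id n).
  apply: het_E; have := @refines_braid_reduce (b1 ++ inv_braid b2) n n (g ∘ f1); rewrite h;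
    apply.
  by rewrite /braid_word map_cat; exact: denotes_comp.
have e2 : E (f2 ∘ g) (Id n).
  apply: het_E; apply: (@refines_inv_braid b2 n n (f2 ∘ g)).
  by rewrite /braid_word map_cat; exact: denotes_comp.
apply: Etrans (Esym (comp1f f1)) _; apply: Etrans (comp_congr (Esym e2) (Erefl f1)) _.
by apply: Etrans (Esym (compA _ _ _)) _; apply: Etrans (comp_congr (Erefl f2) e1) _;
    exact: compf1.
Qed.

(** * Soundness of the comparison of words *)

Lemma refines_delay_births left n w : refines n w (delay_births left n w).
Proof.
rewrite /delay_births; move: fuel => k; exact: (@refines_loop _ _ k n [::] n w birth_sound
  (erefl n)).
Qed.

Lemma layer_ofK x : crossing_layer x -> layer_of (letter_of x) = x.
Proof. by case: x => i []. Qed.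

Lemma braid_word_letters w : all crossing_layer w -> braid_word (map letter_of w) = w.
Proof.
elim: w => //= x w IH /andP[hx hw].
by rewrite /braid_word /= in IH *; rewrite IH // layer_ofK.
Qed.

Lemma all_take_find (T : Type) (a : pred T) s : all (predC a) (take (find a s) s).
Proof. by elim: s => //= x s IH; case: ifP => //= ->. Qed.

(** Postponing the births rewrites c after the births into the births after a
    trivial braid. *)
Lemma slides_toP left n k c b (a : tm n b) (g : tm b b) :
  slides_to left n k c -> denotes (nseq k (0, gσ)) a -> denotes (braid_word c) g -> E (g ∘ a) a.
Proof.
rewrite /slides_to; set w := delay_births _ _ _; set j :=
  find _ _ => /andP[/eqP hred /eqP hd] sa sg.
have : denotes w (g ∘ a) by apply: refines_delay_births; exact: denotes_comp.
rewrite -[X in denotes X](cat_take_drop j) => /denotes_cat[m' [x [y [sx sy' e]]]].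
have hX : all crossing_layer (take j w).
  have /= := all_take_find (predC crossing_layer) w; rewrite -/j.
  by apply: sub_all => z /=; rewrite negbK.
move: sx; rewrite -(braid_word_letters hX) => /refines_braid_reduce; rewrite hred => hx.
have [_ em] := het_dims hx; subst m'.
have ha : denotes (drop j w) a by rewrite hd; apply: refines_delay_births.
apply: het_E; apply: het_trans (E_het e) _.
apply: het_trans (E_het (Etrans (comp_congr (Erefl y) (het_E hx)) (compf1 y))) _.
exact: denotes_inj sy' ha.
Qed.

Lemma slidesP n k c b (a : tm n b) (g : tm b b) :
  slides n k c -> denotes (nseq k (0, gσ)) a -> denotes (braid_word c) g -> E (g ∘ a) a.
Proof. by case/andP=> _ /orP[] h; exact: slides_toP h. Qed.

Lemma nseq_width n k b (a : tm n b) : denotes (nseq k (0, gσ)) a -> b = n + k.*2.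
Proof.
elim: k n a => [|k IH] n a /=; first by move/het_dims=> [_ ->]; rewrite addn0.
case=> j [b' [f' [en s h]]]; have [_ eb] := het_dims h; subst b'.
have en' : 0 + 2 + j = n.+2 by rewrite en.
by move: (IH _ _ s); rewrite /= in en *; lia.
Qed.

Lemma slides_fits n k c b (a : tm n b) : slides n k c -> denotes (nseq k (0, gσ)) a -> fits b c.
Proof. by case/andP=> h _ /nseq_width ->. Qed.

Lemma all_slides n k cs b (a : tm n b) : all (slides n k) cs -> denotes (nseq k (0, gσ)) a ->
  exists g : tm b b, denotes (braid_word (flatten cs)) g /\ E (g ∘ a) a.
Proof.
move=> h sa; elim: cs h => [_|c cs IH /= /andP[hc /IH[g [sg e]]]].
  by exists (Id b); split; [exact: het_refl | exact: comp1f].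
have [g' sg'] := fits_denotes (slides_fits hc sa).
exists (g ∘ g'); split; first by rewrite /braid_word map_cat; exact: denotes_comp.
apply: Etrans (Esym (compA _ _ _)) _; apply: Etrans _ e;
  exact: comp_congr (Erefl g) (slidesP hc sa sg').
Qed.

Lemma denotes_width n w k (f : tm n k) : denotes w f -> k = width n w.
Proof.
elim: w n f => [|[i g] w IH] n f /=; first by case/het_dims.
case=> j [b' [f' [en s h]]]; have [_ eb] := het_dims h; subst b'.
by rewrite (IH _ _ s) en; congr width; lia.
Qed.

Lemma cut_braidP w p b s : cut_braid w = (p, b, s) -> w = p ++ braid_word b ++ s.
Proof.
rewrite /cut_braid; set k := find crossing_layer w; set j :=
  find (predC crossing_layer) (drop k w).
case=> <- <- <-; rewrite braid_word_letters ?cat_take_drop ?cat_take_drop //.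
have /= := all_take_find (predC crossing_layer) (drop k w); rewrite -/j.
by apply: sub_all => z /=; rewrite negbK.
Qed.

Lemma same_wordP n w1 w2 c (f1 : tm n c) c' (f2 : tm n c') :
  same_word n w1 w2 -> denotes w1 f1 -> denotes w2 f2 -> het f1 f2.
Proof.
rewrite /same_word; case E1 : (cut_braid w1) => [[p b1] s];
  case E2 : (cut_braid w2) => [[p2 b2] s2].
rewrite (cut_braidP E1) (cut_braidP E2); case/and3P=> /eqP <- /eqP <- h.
case/denotes_cat=> k [P1 [R1 [sP1 /denotes_cat[k' [B1 [S1 [sB1 sS1 eR1]]]] e1]]].
case/denotes_cat=> k2 [P2 [R2 [sP2 /denotes_cat[k2' [B2 [S2 [sB2 sS2 eR2]]]] e2]]].
have hP := denotes_inj sP1 sP2; have [_ ek] := het_dims hP; subst k2.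
have [_ ek] := denotes_fits sB1; subst k'; have [_ ek] := denotes_fits sB2; subst k2'.
have hS := denotes_inj sS1 sS2; have [_ ec] := het_dims hS; subst c'.
apply: E_het.
suff eB : E (B1 ∘ P1) (B2 ∘ P1).
  have f1E : E f1 (S1 ∘ (B1 ∘ P1)) by apply: Etrans e1
    (Etrans (comp_congr eR1 (Erefl P1)) (Esym (compA _ _ _))).
  have f2E : E f2 (S2 ∘ (B2 ∘ P2)) by apply: Etrans e2
    (Etrans (comp_congr eR2 (Erefl P2)) (Esym (compA _ _ _))).
  apply: Etrans f1E _; apply: Etrans _ (Esym f2E); apply: comp_congr (het_E hS) _.
  exact: Etrans eB (comp_congr (Erefl _) (het_E hP)).
case/orP: h => [h|]; first exact: comp_congr (same_braidP h sB1 sB2) (Erefl _).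
rewrite /same_up_to_slides; set ds := filter _ _; set r := size p - size ds.
set cs := find_slides _ _ _ => /and3P[/eqP ep hcs hb].
move: sP1; rewrite ep => /denotes_cat[n' [D [A [sD sA eP]]]].
rewrite -(denotes_width sD) in hcs.
have [g [sg eg]] := all_slides hcs sA.
have eB : E B1 (B2 ∘ g).
  by apply: same_braidP hb sB1 _; rewrite /braid_word map_cat; exact: denotes_comp.
have eA : E (B1 ∘ A) (B2 ∘ A).
  apply: Etrans (comp_congr eB (Erefl A)) _; apply: Etrans (Esym (compA _ _ _)) _;
    exact: comp_congr (Erefl B2) eg.
apply: Etrans (comp_congr (Erefl B1) eP) _; apply: Etrans (compA _ _ _) _.
apply: Etrans (comp_congr eA (Erefl D)) _; apply: Etrans (Esym (compA _ _ _)) _;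
  exact: comp_congr (Erefl B2) (Esym eP).
Qed.

Lemma same_diagram_sound rs a b (f g : tm a b) : sound rs -> same_diagram rs f g -> E f g.
Proof.
move=> srs; rewrite /same_diagram => /and3P[sf sg h]; apply: het_E.
by apply: same_wordP h _ _; apply: refines_normalize => //; exact: denotes_word_of.
Qed.

(** * Naturality and the bialgebra rules *)

Lemma sound_cat r1 r2 : sound r1 -> sound r2 -> sound (r1 ++ r2).
Proof. by elim: r1 => //= r r1 IH [h1 h2] h3; split=> //; exact: IH. Qed.

Lemma nat11_γ (f : tm 1 1) : γ ∘ (f ⋄ idH) ≡ (idH ⋄ f) ∘ γ /\ γ ∘ (idH ⋄ f) ≡ (f ⋄ idH) ∘ γ.
Proof.
by split; apply: Esym; [exact: (@braid_nat 1 1 1 1 f idH) | exact: (@braid_nat 1 1 1 1 idH f)].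
Qed.

Lemma nat10_γ (f : tm 1 0) : (f ⋄ idH) ∘ γ ≡ idH ⋄ f /\ (idH ⋄ f) ∘ γ ≡ f ⋄ idH.
Proof.
split.
- apply: Etrans (@braid_nat 1 1 1 0 idH f) _; apply: Etrans (comp_congr braid10 (Erefl _)) _;
    exact: comp1f.
- apply: Etrans (@braid_nat 1 1 0 1 f idH) _; apply: Etrans (comp_congr braid01 (Erefl _)) _;
    exact: comp1f.
Qed.

Lemma nat01_γ (f : tm 0 1) : γ ∘ (f ⋄ idH) ≡ idH ⋄ f /\ γ ∘ (idH ⋄ f) ≡ f ⋄ idH.
Proof.
split; apply: Esym.
- apply: Etrans (Esym (Etrans (comp_congr (Erefl (idH ⋄ f)) braid01) (compf1 (idH ⋄ f)))) _.
  exact: (@braid_nat 0 1 1 1 f idH).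
- apply: Etrans (Esym (Etrans (comp_congr (Erefl (f ⋄ idH)) braid10) (compf1 (f ⋄ idH)))) _.
  exact: (@braid_nat 1 0 1 1 idH f).
Qed.

Lemma nat21_γ (f : tm 2 1) :
  γ ∘ (f ⋄ idH) ≡ (idH ⋄ f) ∘ ((γ ⋄ idH) ∘ (idH ⋄ γ)) /\
  γ ∘ (idH ⋄ f) ≡ (f ⋄ idH) ∘ ((idH ⋄ γ) ∘ (γ ⋄ idH)).
Proof.
split; apply: Esym.
- apply: Etrans (comp_congr (Erefl (idH ⋄ f)) (Esym braid21)) _;
    exact: (@braid_nat 2 1 1 1 f idH).
- apply: Etrans (comp_congr (Erefl (f ⋄ idH)) (Esym braid12)) _;
    exact: (@braid_nat 1 2 1 1 idH f).
Qed.

Lemma nat12_γ (f : tm 1 2) :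
  (f ⋄ idH) ∘ γ ≡ ((idH ⋄ γ) ∘ (γ ⋄ idH)) ∘ (idH ⋄ f) /\
  (idH ⋄ f) ∘ γ ≡ ((γ ⋄ idH) ∘ (idH ⋄ γ)) ∘ (f ⋄ idH).
Proof.
split.
- apply: Etrans (@braid_nat 1 1 1 2 idH f) _; exact: comp_congr braid12 (Erefl _).
- apply: Etrans (@braid_nat 1 1 2 1 f idH) _; exact: comp_congr braid21 (Erefl _).
Qed.

Lemma mk_rule a b (f g : tm a b) : simple f && simple g -> f ≡ g -> sound_rule (Eqn f g).
Proof. by case/andP=> sf sg h; split. Qed.

Lemma nat11_sound (f : tm 1 1) : simple f -> sound (nat11 γ f) /\ sound (nat11 γbar f).
Proof.
move=> sf; have [h1 h2] := nat11_γ f.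
split; (split; [|split=> //]); apply: mk_rule; rewrite /= ?sf //.
- exact: (intertwine_inv γK γbarK h2).
- exact: (intertwine_inv γK γbarK h1).
Qed.

Lemma nat10_sound (f : tm 1 0) : simple f -> sound (nat10 γ f) /\ sound (nat10 γbar f).
Proof.
move=> sf; have [h1 h2] := nat10_γ f.
split; (split; [|split=> //]); apply: mk_rule; rewrite /= ?sf //.
- exact: (comp_moveR γbarK (Esym h2)).
- exact: (comp_moveR γbarK (Esym h1)).
Qed.

Lemma nat_sound : sound (nat_rules γ) /\ sound (nat_rules γbar).
Proof.
have KA : (γbar ⋄ idH) ∘ (idH ⋄ γbar) ∘ ((idH ⋄ γ) ∘ (γ ⋄ idH)) ≡ Id 3.
  exact: comp_inv (ten_inv_l γK) (ten_inv_r γK).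
have KB : (idH ⋄ γbar) ∘ (γbar ⋄ idH) ∘ ((γ ⋄ idH) ∘ (idH ⋄ γ)) ≡ Id 3.
  exact: comp_inv (ten_inv_r γK) (ten_inv_l γK).
have KA' : (idH ⋄ γ) ∘ (γ ⋄ idH) ∘ ((γbar ⋄ idH) ∘ (idH ⋄ γbar)) ≡ Id 3.
  exact: comp_inv (ten_inv_r γbarK) (ten_inv_l γbarK).
have KB' : (γ ⋄ idH) ∘ (idH ⋄ γ) ∘ ((idH ⋄ γbar) ∘ (γbar ⋄ idH)) ≡ Id 3.
  exact: comp_inv (ten_inv_l γbarK) (ten_inv_r γbarK).
have [s1 s2] := nat11_sound (f := SH) isT; have [s3 s4] := nat11_sound (f := SbarH) isT.
have [s5 s6] := nat11_sound (f := v) isT; have [s7 s8] := nat11_sound (f := vbar) isT.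
have [s9 s10] := nat10_sound (f := ε) isT; have [s11 s12] := nat10_sound (f := l) isT.
have [m1 m2] := nat21_γ m; have [h1 h2] := nat01_γ η; have [d1 d2] := nat12_γ Δ.
split; do 6!(apply: sound_cat => //); do 6?(split; first apply: mk_rule) => //.
- exact: Etrans m1 (compA _ _ _).
- exact: Etrans m2 (compA _ _ _).
- exact: Etrans (intertwine_inv γK KA' m2) (compA _ _ _).
- exact: Etrans (intertwine_inv γK KB' m1) (compA _ _ _).
- exact: (comp_moveL (A := idH ⋄ η) (B := η ⋄ idH) γK h2).
- exact: (comp_moveL (A := η ⋄ idH) (B := idH ⋄ η) γK h1).
- exact: Esym (intertwine_inv (A := Δ ⋄ idH) (B := idH ⋄ Δ) KB γbarK (Esym d2)).
- exact: Esym (intertwine_inv (A := idH ⋄ Δ) (B := Δ ⋄ idH) KA γbarK (Esym d1)).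
Qed.

Lemma braided_sound : sound braided_rules.
Proof.
have [s1 s2] := nat_sound.
apply: sound_cat => //; apply: sound_cat => //.
do 4?(split; first apply: mk_rule) => //; [exact: γbarK | exact: γK | | ].
- by have [[_ _ h] _] := birth_sound; exact: Esym h.
- exact: Esym (nat01_γ L).1.
Qed.

Hypothesis EA : forall x, selfdual_ax x -> x <> ax_r8 -> x <> ax_r9 -> holds E x.

Lemma bialg_sound : sound bialg_rules.
Proof.
do 14?(split; first apply: mk_rule) => //.
- exact: (Esym (EA (x := ax_a1) isT _ _)).
- exact: (EA (x := ax_a2)).
- exact: (EA (x := ax_a2')).
- exact: (Esym (EA (x := ax_a3) isT _ _)).
- exact: (EA (x := ax_a4)).
- exact: (EA (x := ax_a4')).
- exact: (Esym (EA (x := ax_a5) isT _ _)).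
- exact: (EA (x := ax_a6)).
- exact: (EA (x := ax_a7)).
- exact: (EA (x := ax_a8)).
- exact: (EA (x := ax_s2)).
- exact: (EA (x := ax_s2')).
- exact: (EA (x := ax_vK)).
- exact: (EA (x := ax_vbarK)).
Qed.

Lemma bi_sound : sound bi_rules. Proof. exact: sound_cat braided_sound bialg_sound. Qed.

(** Rewriting inside a context: f only has to agree with C x up to comparison of
    normal forms. *)
Lemma via_sound rs (srs : sound rs) a b c d (x y : tm a b) (xy : x ≡ y) (C : tm a b -> tm c d)
  (f g : tm c d) :
  (forall u w, u ≡ w -> C u ≡ C w) -> same_diagram rs f (C x) -> C y ≡ g -> f ≡ g.
Proof. move=> HC i e; exact: Etrans (same_diagram_sound srs i) (Etrans (HC _ _ xy) e). Qed.

Ltac congr_with e := lazymatch goal with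
  | |- E ?f ?f => exact (Erefl f)
  | |- E (Ten ?f ?g) (Ten ?f' ?g') =>
      refine (@ten_congr _ _ _ _ f f' g g' _ _); congr_with e
  | |- E (Comp ?f ?g) (Comp ?f' ?g') =>
      refine (@comp_congr _ _ _ f f' g g' _ _); congr_with e
  | |- _ => exact e
  end.
Ltac context_congr := let x := fresh in let y := fresh in let e := fresh in
  intros x y e; cbv beta; congr_with e.

(** The rules established so far; redefined below when more of them are
    available. *)
Ltac known_rules := exact: bi_sound.
Ltac by_diagram := apply: same_diagram_sound; [known_rules | vm_compute; reflexivity].

Tactic Notation "via" uconstr(C) uconstr(H) :=
  refine (@via_sound _ _ _ _ _ _ _ _ H C _ _ _ _ _);
  [known_rules | context_congr | vm_compute; reflexivity | cbv beta].

(** * The antipode *)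

Lemma antipodeL : m ∘ (SH ⋄ idH) ∘ Δ ≡ η ∘ ε. Proof. exact: (EA (x := ax_s1)). Qed.
Lemma antipodeR : m ∘ (idH ⋄ SH) ∘ Δ ≡ η ∘ ε. Proof. exact: (EA (x := ax_s1')). Qed.
Definition mulHH : tm 4 2 := (m ⋄ m) ∘ (idH ⋄ γ ⋄ idH).
Definition comulHH : tm 2 4 := (idH ⋄ γ ⋄ idH) ∘ (Δ ⋄ Δ).

(** Both sides are inverse to m for convolution. *)
Lemma antipode_mul : SH ∘ m ≡ m ∘ (SH ⋄ SH) ∘ γ.
Proof.
apply: Esym.
via (fun x => m ∘ ((m ∘ (SH ⋄ SH) ∘ γ) ⋄ (x ∘ m)) ∘ comulHH) (Esym antipodeR).
via (fun x => m ∘ ((m ∘ (m ⋄ idH) ∘ (SH ⋄ x ⋄ idH) ∘ (γ ⋄ idH) ∘ (idH ⋄ Δ)) ⋄ (SH ∘ m)) ∘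
  comulHH) antipodeL.
via (fun x => m ∘ ((ε ⋄ x) ⋄ (SH ∘ m)) ∘ comulHH) antipodeL.
by_diagram.
Qed.

Lemma ten_comp3_r a b c d e f (G : tm a b) (A : tm c d) (B : tm e c) (D : tm f e) :
  G ⋄ (A ∘ B ∘ D) ≡ (Id b ⋄ A) ∘ (G ⋄ B) ∘ (Id a ⋄ D).
Proof.
apply: Etrans (ten_congr (Esym (compf1 G)) (Erefl _)) _; apply: Etrans (interchange _ _ _ _) _.
apply: comp_congr (Erefl _); apply: Etrans (ten_congr (Esym (comp1f G)) (Erefl _)) _;
  exact: interchange.
Qed.

Lemma ten_comp3_l a b c d e f (G : tm a b) (A : tm c d) (B : tm e c) (D : tm f e) :
  (A ∘ B ∘ D) ⋄ G ≡ (A ⋄ Id b) ∘ (B ⋄ G) ∘ (D ⋄ Id a).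
Proof.
apply: Etrans (ten_congr (Erefl _) (Esym (compf1 G))) _; apply: Etrans (interchange _ _ _ _) _.
apply: comp_congr (Erefl _); apply: Etrans (ten_congr (Erefl _) (Esym (comp1f G))) _;
  exact: interchange.
Qed.

Lemma reassoc a b c d e f (p : tm e f) (x : tm d e) (y : tm c d) (z : tm b c) (w : tm a b) :
  p ∘ (x ∘ y ∘ z) ∘ w ≡ (p ∘ x) ∘ (y ∘ (z ∘ w)).
Proof.
apply: Etrans (comp_congr (Etrans (comp_congr (Erefl p) (Esym (compA x y z))) (compA p x _))
  (Erefl w)) _.
apply: Etrans (Esym (compA _ _ w)) _; exact: comp_congr (Erefl _) (Esym (compA y z w)).
Qed.

(** Associativity of convolution of morphisms from H to its braided tensor
    square. *)
Lemma convolutionA (F G K : tm 1 2) :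
  mulHH ∘ (G ⋄ (mulHH ∘ (K ⋄ F) ∘ Δ)) ∘ Δ ≡ mulHH ∘ ((mulHH ∘ (G ⋄ K) ∘ Δ) ⋄ F) ∘ Δ.
Proof.
have eA : mulHH ∘ (Id 2 ⋄ mulHH) ≡ mulHH ∘ (mulHH ⋄ Id 2) by by_diagram.
have eD : (idH ⋄ Δ) ∘ Δ ≡ (Δ ⋄ idH) ∘ Δ by by_diagram.
have eT : G ⋄ (K ⋄ F) ≡ (G ⋄ K) ⋄ F.
  by have := @law_tenA _ _ EL _ _ _ _ _ _ G K F; rewrite castmE.
refine (Etrans (comp_congr (comp_congr (Erefl mulHH) (ten_comp3_r G mulHH (K ⋄ F) Δ))
  (Erefl Δ)) _).
refine (Etrans (reassoc mulHH (Id 2 ⋄ mulHH) (G ⋄ (K ⋄ F)) (idH ⋄ Δ) Δ) _).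
refine (Etrans (comp_congr eA (comp_congr eT eD)) (Esym _)).
refine (Etrans (comp_congr (comp_congr (Erefl mulHH) (ten_comp3_l F mulHH (G ⋄ K) Δ))
  (Erefl Δ)) _).
exact (reassoc mulHH (mulHH ⋄ Id 2) ((G ⋄ K) ⋄ F) (Δ ⋄ idH) Δ).
Qed.

(** Both sides are inverse to Δ for convolution. *)
Lemma comul_antipode : Δ ∘ SH ≡ (SH ⋄ SH) ∘ γ ∘ Δ.
Proof.
pose G := (SH ⋄ SH) ∘ γ ∘ Δ.
have GK : mulHH ∘ (G ⋄ Δ) ∘ Δ ≡ η ⋄ η ∘ ε.
  via (fun x => (idH ⋄ m) ∘ (γ ⋄ idH) ∘ (SH ⋄ x ⋄ idH) ∘ (idH ⋄ Δ) ∘ Δ) antipodeL.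
  via (fun x => η ⋄ x) antipodeL.
  by_diagram.
have KF : mulHH ∘ (Δ ⋄ (Δ ∘ SH)) ∘ Δ ≡ η ⋄ η ∘ ε.
  via (fun x => Δ ∘ x) antipodeR.
  by_diagram.
have e1 : mulHH ∘ (G ⋄ (η ⋄ η ∘ ε)) ∘ Δ ≡ G by by_diagram.
have e2 : mulHH ∘ ((η ⋄ η ∘ ε) ⋄ (Δ ∘ SH)) ∘ Δ ≡ Δ ∘ SH by by_diagram.
apply: Esym; apply: Etrans (Esym e1) (Etrans _ e2).
apply: Etrans (comp_congr (comp_congr (Erefl mulHH) (ten_congr (Erefl G) (Esym KF))) (Erefl Δ))
  _.
apply: Etrans (convolutionA _ _ _) _.
exact: comp_congr (comp_congr (Erefl mulHH) (ten_congr GK (Erefl _))) (Erefl Δ).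
Qed.

Lemma antipode_unit : SH ∘ η ≡ η.
Proof. via (fun x => x ∘ η) antipodeL. by_diagram. Qed.

Lemma counit_antipode : ε ∘ SH ≡ ε.
Proof. via (fun x => ε ∘ x) antipodeR. by_diagram. Qed.

(** The rules for SbarH come from those for SH by composing with SbarH on both
    sides. *)
Lemma anti_sound : sound anti_rules.
Proof.
do 8?(split; first apply: mk_rule) => //.
- exact: antipode_mul.
- via (fun x => SbarH ∘ x ∘ γbar ∘ (SbarH ⋄ SbarH)) (Esym antipode_mul). by_diagram.
- exact: comul_antipode.
- via (fun x => (SbarH ⋄ SbarH) ∘ γbar ∘ x ∘ SbarH) (Esym comul_antipode). by_diagram.
- exact: antipode_unit.
- via (fun x => SbarH ∘ x) (Esym antipode_unit). by_diagram.
- exact: counit_antipode.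
- via (fun x => x ∘ SbarH) (Esym counit_antipode). by_diagram.
Qed.

Lemma hopf_sound : sound hopf_rules.
Proof. exact: sound_cat bi_sound anti_sound. Qed.

(** * The skew antipode, the integrals and the ribbon morphism *)

Ltac known_rules ::= exact: hopf_sound.

(** SbarH applied to an antipode identity; it reverses products along γbar. *)
Lemma skew_antipodeL : m ∘ γbar ∘ (SbarH ⋄ idH) ∘ Δ ≡ η ∘ ε.
Proof. via (fun x => SbarH ∘ x) antipodeR. by_diagram. Qed.

Lemma skew_antipodeR : m ∘ γbar ∘ (idH ⋄ SbarH) ∘ Δ ≡ η ∘ ε.
Proof. via (fun x => SbarH ∘ x) antipodeL. by_diagram. Qed.

Lemma antipode_ribbon : SH ∘ v ≡ v ∘ SH. Proof. exact: (EA (x := ax_r3)). Qed.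
Lemma ribbon_mulL : m ∘ (v ⋄ idH) ≡ v ∘ m. Proof. exact: (EA (x := ax_r5)). Qed.
Lemma copairing_ribbon : σ ≡ (vbar ⋄ (vbar ∘ SH)) ∘ Δ ∘ v ∘ η.
Proof. exact: (EA (x := ax_r6)). Qed.
Lemma comulL_copairing : (Δ ⋄ idH) ∘ σ ≡ (idH ⋄ idH ⋄ m) ∘ (idH ⋄ σ ⋄ idH) ∘ σ.
Proof. exact: (EA (x := ax_r7)). Qed.
Lemma ribbon_counit : ε ∘ v ≡ ε. Proof. exact: (EA (x := ax_r4)). Qed.
Lemma cointegralR : (idH ⋄ l) ∘ Δ ≡ η ∘ l. Proof. exact: (EA (x := ax_i1)). Qed.
Lemma integralL : m ∘ (L ⋄ idH) ≡ L ∘ ε. Proof. exact: (EA (x := ax_i2)). Qed.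
Lemma cointegral_integral : l ∘ L ≡ Id 0. Proof. exact: (EA (x := ax_i3)). Qed.
Lemma antipode_integral : SH ∘ L ≡ L. Proof. exact: (EA (x := ax_i4)). Qed.
Lemma cointegral_antipode : l ∘ SH ≡ l. Proof. exact: (EA (x := ax_i5)). Qed.
Lemma cointegral_copairing : (l ⋄ idH) ∘ σ ≡ L. Proof. exact: (EA (x := ax_d)). Qed.

Lemma skew_antipode_ribbon : SbarH ∘ v ≡ v ∘ SbarH.
Proof. via (fun x => SbarH ∘ x ∘ SbarH) (Esym antipode_ribbon). by_diagram. Qed.

(** The antipode exchanges left and right multiplication and commutes with v. *)
Lemma ribbon_mulR : m ∘ (idH ⋄ v) ≡ v ∘ m.
Proof.
via (fun x => SH ∘ m ∘ (x ⋄ SbarH) ∘ γbar) skew_antipode_ribbon.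
via (fun x => SH ∘ x ∘ (SbarH ⋄ SbarH) ∘ γbar) ribbon_mulL.
via (fun x => x ∘ m ∘ (SbarH ⋄ SbarH) ∘ γbar) antipode_ribbon.
by_diagram.
Qed.

Lemma ribbon_sound : sound ribbon_rules.
Proof.
apply: sound_cat hopf_sound _.
do 14?(split; first apply: mk_rule) => //.
- exact: cointegral_antipode.
- via (fun x => x ∘ SbarH) (Esym cointegral_antipode). by_diagram.
- exact: antipode_integral.
- via (fun x => SbarH ∘ x) (Esym antipode_integral). by_diagram.
- exact: ribbon_counit.
- via (fun x => x ∘ vbar) (Esym ribbon_counit). by_diagram.
- exact: ribbon_mulL.
- via (fun x => vbar ∘ x ∘ (vbar ⋄ idH)) (Esym ribbon_mulL). by_diagram.
- exact: ribbon_mulR.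
- via (fun x => vbar ∘ x ∘ (idH ⋄ vbar)) (Esym ribbon_mulR). by_diagram.
- exact: antipode_ribbon.
- via (fun x => vbar ∘ x ∘ vbar) (Esym antipode_ribbon). by_diagram.
- exact: skew_antipode_ribbon.
- via (fun x => vbar ∘ x ∘ vbar) (Esym skew_antipode_ribbon). by_diagram.
Qed.

Ltac known_rules ::= exact: ribbon_sound.

(** * The twisted copairing *)

(** The twist makes W multiplicative for the braided tensor square in both legs, as an
    R-matrix is. *)
Definition W : tm 0 2 := (idH ⋄ SbarH) ∘ σ.

Lemma W_ribbon : W ≡ (vbar ⋄ vbar) ∘ Δ ∘ (v ∘ η).
Proof. via (fun x => (idH ⋄ SbarH) ∘ x) copairing_ribbon. by_diagram. Qed.

(** By r6, W comes from Δ ∘ v ∘ η; the antipode fixes v ∘ η and reverses Δ. *)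
Lemma W_flip : W ≡ (SH ⋄ SH) ∘ γ ∘ W.
Proof.
apply: Etrans W_ribbon _; apply: Esym.
have e : (SH ⋄ SH) ∘ γ ∘ (vbar ⋄ vbar) ≡ (vbar ⋄ vbar) ∘ (SH ⋄ SH) ∘ γ by by_diagram.
via (fun x => (SH ⋄ SH) ∘ γ ∘ x) W_ribbon.
via (fun x => x ∘ Δ ∘ (v ∘ η)) e.
via (fun x => (vbar ⋄ vbar) ∘ x ∘ (v ∘ η)) (Esym comul_antipode).
by_diagram.
Qed.

Lemma W_flip_skew : W ≡ (SbarH ⋄ SbarH) ∘ γbar ∘ W.
Proof. apply: Esym. via (fun x => (SbarH ⋄ SbarH) ∘ γbar ∘ x) W_flip. by_diagram. Qed.

Lemma W_comulL : (Δ ⋄ idH) ∘ W ≡ (Id 2 ⋄ m) ∘ (idH ⋄ γ ⋄ idH) ∘ (W ⋄ W).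
Proof. via (fun x => (Id 2 ⋄ SbarH) ∘ x) comulL_copairing. by_diagram. Qed.

(** [W_flip] exchanges the two legs. *)
Lemma W_comulR : (idH ⋄ Δ) ∘ W ≡ (m ⋄ Id 2) ∘ (idH ⋄ γ ⋄ idH) ∘ (W ⋄ W).
Proof.
via (fun x => (idH ⋄ Δ) ∘ x) W_flip.
via (fun x => (SH ⋄ SH ⋄ SH) ∘ (idH ⋄ γ) ∘ (γ ⋄ idH) ∘ (idH ⋄ γ) ∘ x) W_comulL.
apply: Esym.
via (fun x => (m ⋄ Id 2) ∘ (idH ⋄ γ ⋄ idH) ∘ (x ⋄ W)) W_flip.
via (fun x => (m ⋄ Id 2) ∘ (idH ⋄ γ ⋄ idH) ∘ (((SH ⋄ SH) ∘ γ ∘ W) ⋄ x)) W_flip.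
by_diagram.
Qed.

Lemma W_counitL : (ε ⋄ idH) ∘ W ≡ η.
Proof. via (fun x => (ε ⋄ idH) ∘ x) W_ribbon. by_diagram. Qed.

Lemma W_counitR : (idH ⋄ ε) ∘ W ≡ η.
Proof. via (fun x => (idH ⋄ ε) ∘ x) W_ribbon. by_diagram. Qed.

(** σ is W with an antipode on a leg, and in a multiplicative leg an antipode
    produces the inverse. *)
Lemma mul_W_σ : mulHH ∘ (W ⋄ σ) ≡ η ⋄ η.
Proof.
via (fun x => (idH ⋄ (m ∘ (idH ⋄ SH))) ∘ x) (Esym W_comulR).
via (fun x => (idH ⋄ x) ∘ W) antipodeR.
via (fun x => x ⋄ η) W_counitR.
by_diagram.
Qed.

Lemma mul_W_SW : mulHH ∘ (W ⋄ ((SH ⋄ idH) ∘ W)) ≡ η ⋄ η.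
Proof.
via (fun x => ((m ∘ (idH ⋄ SH)) ⋄ idH) ∘ x) (Esym W_comulL).
via (fun x => (x ⋄ idH) ∘ W) antipodeR.
via (fun x => η ⋄ x) W_counitL.
by_diagram.
Qed.

(** The formula for W with v and vbar exchanged. *)
Definition σ_of_ribbon : tm 0 2 := (v ⋄ v) ∘ Δ ∘ (vbar ∘ η).
Lemma mul_vbarη_vη : m ∘ ((vbar ∘ η) ⋄ (v ∘ η)) ≡ η. Proof. by_diagram. Qed.

Lemma mul_twisted_comul (p q : tm 0 1) :
  mulHH ∘ (((v ⋄ v) ∘ Δ ∘ p) ⋄ ((vbar ⋄ vbar) ∘ Δ ∘ q)) ≡ Δ ∘ (m ∘ (p ⋄ q)).
Proof.
pose A := (v ⋄ v) ∘ Δ; pose B := (vbar ⋄ vbar) ∘ Δ.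
have e1 : mulHH ∘ ((A ∘ p) ⋄ (B ∘ q)) ≡ mulHH ∘ ((A ⋄ B) ∘ (p ⋄ q)).
  exact (comp_congr (Erefl mulHH) (interchange A p B q)).
have e2 : mulHH ∘ (A ⋄ B) ≡ Δ ∘ m by by_diagram.
exact (Etrans e1 (Etrans (compA mulHH (A ⋄ B) (p ⋄ q))
  (Etrans (comp_congr e2 (Erefl (p ⋄ q))) (Esym (compA Δ m (p ⋄ q)))))).
Qed.

(** The ribbon morphism is linear, so v and vbar cancel in the product. *)
Lemma mul_σ_of_ribbon_W : mulHH ∘ (σ_of_ribbon ⋄ W) ≡ η ⋄ η.
Proof.
refine (Etrans (comp_congr (Erefl mulHH) (ten_congr (Erefl σ_of_ribbon) W_ribbon))
  (Etrans (mul_twisted_comul (vbar ∘ η) (v ∘ η)) _)).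
via (fun x => Δ ∘ x) mul_vbarη_vη.
by_diagram.
Qed.

(** A left inverse and a right inverse of W coincide. *)
Lemma σ_of_ribbonE : σ_of_ribbon ≡ σ.
Proof.
via (fun x => mulHH ∘ (σ_of_ribbon ⋄ x)) (Esym mul_W_σ).
via (fun x => mulHH ∘ (x ⋄ σ)) mul_σ_of_ribbon_W.
by_diagram.
Qed.

Lemma σ_ribbon : σ ≡ (v ⋄ v) ∘ Δ ∘ (vbar ∘ η). Proof. exact: Esym σ_of_ribbonE. Qed.

(** Both sides are right inverses of W, which has a left inverse. *)
Lemma W_antipodeL : (SH ⋄ idH) ∘ W ≡ σ.
Proof.
via (fun x => mulHH ∘ (x ⋄ ((SH ⋄ idH) ∘ W))) (Esym mul_σ_of_ribbon_W).
via (fun x => mulHH ∘ (σ_of_ribbon ⋄ x)) mul_W_SW.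
via (fun x => x) σ_of_ribbonE.
by_diagram.
Qed.

Lemma W_antipode_slide : (SH ⋄ idH) ∘ W ≡ (idH ⋄ SH) ∘ W.
Proof. apply: Etrans W_antipodeL _; by_diagram. Qed.

Lemma mul_vη_l : m ∘ ((v ∘ η) ⋄ idH) ≡ v. Proof. by_diagram. Qed.
Lemma mul_vη_r : m ∘ (idH ⋄ (v ∘ η)) ≡ v. Proof. by_diagram. Qed.
Lemma mul_vbarη_l : m ∘ ((vbar ∘ η) ⋄ idH) ≡ vbar. Proof. by_diagram. Qed.
Lemma mul_vbarη_r : m ∘ (idH ⋄ (vbar ∘ η)) ≡ vbar. Proof. by_diagram. Qed.

Lemma mulHH_comp_r (B Y : tm 1 2) (p : tm 0 1) :
  mulHH ∘ (Δ ⋄ B) ≡ Y ∘ m -> mulHH ∘ (Δ ⋄ (B ∘ p)) ≡ Y ∘ (m ∘ (idH ⋄ p)).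
Proof.
move=> e.
have e1 : Δ ⋄ (B ∘ p) ≡ (Δ ⋄ B) ∘ (idH ⋄ p).
  refine (Etrans (ten_congr (Esym _) (Erefl (B ∘ p))) (interchange Δ idH B p)); exact: compf1.
exact (Etrans (comp_congr (Erefl mulHH) e1) (Etrans (compA mulHH (Δ ⋄ B) (idH ⋄ p))
  (Etrans (comp_congr e (Erefl (idH ⋄ p))) (Esym (compA Y m (idH ⋄ p)))))).
Qed.

Lemma mulHH_comp_l (B Y : tm 1 2) (p : tm 0 1) :
  mulHH ∘ (B ⋄ Δ) ≡ Y ∘ m -> mulHH ∘ ((B ∘ p) ⋄ Δ) ≡ Y ∘ (m ∘ (p ⋄ idH)).
Proof.
move=> e.
have e1 : (B ∘ p) ⋄ Δ ≡ (B ⋄ Δ) ∘ (p ⋄ idH).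
  refine (Etrans (ten_congr (Erefl (B ∘ p)) (Esym _)) (interchange B p Δ idH)); exact: compf1.
exact (Etrans (comp_congr (Erefl mulHH) e1) (Etrans (compA mulHH (B ⋄ Δ) (p ⋄ idH))
  (Etrans (comp_congr e (Erefl (p ⋄ idH))) (Esym (compA Y m (p ⋄ idH)))))).
Qed.

(** By linearity of v and vbar on both sides, each product is
    (vbar ⋄ vbar) ∘ Δ ∘ v. *)
Lemma W_central : mulHH ∘ (Δ ⋄ W) ≡ mulHH ∘ (W ⋄ Δ).
Proof.
have W_r : mulHH ∘ (Δ ⋄ W) ≡ (vbar ⋄ vbar) ∘ Δ ∘ v.
  refine (Etrans (comp_congr (Erefl mulHH) (ten_congr (Erefl Δ) W_ribbon)) _).
  refine (Etrans (@mulHH_comp_r ((vbar ⋄ vbar) ∘ Δ) ((vbar ⋄ vbar) ∘ Δ) (v ∘ η) _) _);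
    first by by_diagram.
  exact (comp_congr (Erefl _) mul_vη_r).
refine (Etrans W_r (Esym _)).
refine (Etrans (comp_congr (Erefl mulHH) (ten_congr W_ribbon (Erefl Δ))) _).
refine (Etrans (@mulHH_comp_l ((vbar ⋄ vbar) ∘ Δ) ((vbar ⋄ vbar) ∘ Δ) (v ∘ η) _) _);
  first by by_diagram.
exact (comp_congr (Erefl _) mul_vη_l).
Qed.

Lemma mul_Δ_σ : mulHH ∘ (Δ ⋄ σ) ≡ (v ⋄ v) ∘ Δ ∘ vbar.
Proof.
refine (Etrans (comp_congr (Erefl mulHH) (ten_congr (Erefl Δ) σ_ribbon)) _).
refine (Etrans (@mulHH_comp_r ((v ⋄ v) ∘ Δ) ((v ⋄ v) ∘ Δ) (vbar ∘ η) _) _); first by by_diagram.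
exact (comp_congr (Erefl _) mul_vbarη_r).
Qed.

Lemma mul_σ_Δ : mulHH ∘ (σ ⋄ Δ) ≡ (v ⋄ v) ∘ Δ ∘ vbar.
Proof.
refine (Etrans (comp_congr (Erefl mulHH) (ten_congr σ_ribbon (Erefl Δ))) _).
refine (Etrans (@mulHH_comp_l ((v ⋄ v) ∘ Δ) ((v ⋄ v) ∘ Δ) (vbar ∘ η) _) _); first by by_diagram.
exact (comp_congr (Erefl _) mul_vbarη_l).
Qed.

Lemma σ_central : mulHH ∘ (Δ ⋄ σ) ≡ mulHH ∘ (σ ⋄ Δ).
Proof. exact: Etrans mul_Δ_σ (Esym mul_σ_Δ). Qed.

(** * Nondegeneracy *)

Lemma cointegralL : (l ⋄ idH) ∘ Δ ≡ η ∘ l.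
Proof.
via (fun x => SbarH ∘ x ∘ SH) cointegralR.
by_diagram.
Qed.

Lemma integralR : m ∘ (idH ⋄ L) ≡ L ∘ ε.
Proof.
via (fun x => m ∘ (idH ⋄ x)) (Esym antipode_integral).
via (fun x => SH ∘ x ∘ SbarH) integralL.
by_diagram.
Qed.

Lemma cointegral_W : (l ⋄ idH) ∘ W ≡ L.
Proof.
via (fun x => SbarH ∘ x) cointegral_copairing.
by_diagram.
Qed.

(** By (d) the integral is a leg of W paired with the cointegral, and
    [W_comulR] doubles W. *)
Lemma comul_integral : Δ ∘ L ≡ ((l ∘ m) ⋄ Id 2) ∘ (idH ⋄ γ ⋄ idH) ∘ (W ⋄ W).
Proof.
via (fun x => Δ ∘ x) (Esym cointegral_W).
via (fun x => (l ⋄ Id 2) ∘ x) W_comulR.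
by_diagram.
Qed.

(** The Frobenius property of the integral: inserting S(x(1)) x(2) makes x(2)
    meet Δ ∘ L, which absorbs it. *)
Lemma integral_pass : (idH ⋄ m) ∘ (γ ⋄ idH) ∘ (idH ⋄ (Δ ∘ L)) ≡ (m ⋄ idH) ∘ (SH ⋄ (Δ ∘ L)).
Proof.
via (fun x => mulHH ∘ (((x ⋄ idH) ∘ Δ) ⋄ (Δ ∘ L))) (Esym antipodeL).
via (fun x => (m ⋄ idH) ∘ (SH ⋄ (Δ ∘ x)) ∘ Δ) integralR.
by_diagram.
Qed.

Lemma cointegral_comul_integral : (l ⋄ idH) ∘ Δ ∘ L ≡ η.
Proof.
via (fun x => x ∘ L) cointegralL.
via (fun x => η ∘ x) cointegral_integral.
by_diagram.
Qed.

Lemma integral_pairing : ((l ∘ m) ⋄ idH) ∘ (SH ⋄ (Δ ∘ L)) ≡ idH.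
Proof.
via (fun x => (l ⋄ idH) ∘ x) (Esym integral_pass).
via (fun x => m ∘ (idH ⋄ x)) cointegral_comul_integral.
by_diagram.
Qed.

(** The pairing to which W is dual, read off from [integral_pairing] once Δ ∘ L has been
    expanded by [comul_integral]. *)
Definition ϖ : tm 2 0 := l ∘ m ∘ (idH ⋄ (l ∘ m) ⋄ idH) ∘ (Id 2 ⋄ γ) ∘ (SH ⋄ W ⋄ idH).

Lemma W_nondegenerate : (ϖ ⋄ idH) ∘ (idH ⋄ W) ≡ idH.
Proof.
via (fun x => ((l ∘ m) ⋄ idH) ∘ (SH ⋄ x)) (Esym comul_integral).
exact: integral_pairing.
Qed.

Lemma ten1f a b (f : tm a b) : Id 0 ⋄ f ≡ f.
Proof. by have := @law_ten1f _ _ EL _ _ f; rewrite castmE. Qed.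

Lemma tenA1 k (f : tm 1 k) : idH ⋄ (idH ⋄ f) ≡ Id 2 ⋄ f.
Proof.
have e : idH ⋄ (idH ⋄ f) ≡ (idH ⋄ idH) ⋄ f.
  by have := @law_tenA _ _ EL _ _ _ _ _ _ idH idH f; rewrite castmE.
exact (Etrans e (ten_congr (@law_ten_id _ _ EL 1 1) (Erefl f))).
Qed.

(** Pairing the first leg with ϖ recovers f from (idH ⋄ f) ∘ W. *)
Lemma W_cancel k (f g : tm 1 k) : (idH ⋄ f) ∘ W ≡ (idH ⋄ g) ∘ W -> f ≡ g.
Proof.
have H (h : tm 1 k) : h ≡ (ϖ ⋄ Id k) ∘ (idH ⋄ ((idH ⋄ h) ∘ W)).
  have e1 : h ∘ (ϖ ⋄ idH) ≡ (ϖ ⋄ Id k) ∘ (Id 2 ⋄ h).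
    exact (Etrans (comp_congr (Esym (ten1f h)) (Erefl (ϖ ⋄ idH)))
      (Etrans (ten_lr ϖ h) (Esym (ten_rl ϖ h)))).
  have e2 : idH ⋄ ((idH ⋄ h) ∘ W) ≡ (Id 2 ⋄ h) ∘ (idH ⋄ W).
    exact (Etrans (ten_congr (Esym (compf1 idH)) (Erefl _))
      (Etrans (interchange idH idH (idH ⋄ h) W)
            (comp_congr (tenA1 h) (Erefl _)))).
  exact (Etrans (Esym (compf1 h)) (Etrans (comp_congr (Erefl h) (Esym W_nondegenerate))
    (Etrans (compA h (ϖ ⋄ idH) (idH ⋄ W))
    (Etrans (comp_congr e1 (Erefl (idH ⋄ W))) (Etrans
    (Esym (compA (ϖ ⋄ Id k) (Id 2 ⋄ h) (idH ⋄ W))) (comp_congr (Erefl _) (Esym e2))))))).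
move=> e; refine (Etrans (H f) (Etrans _ (Esym (H g)))).
exact (comp_congr (Erefl _) (ten_congr (Erefl idH) e)).
Qed.

(** * The adjoint action on the copairing *)

(** The adjoint coaction x ↦ x(2) ⋄ S(x(1)) x(3), where x(1) passes over
    x(2). *)
Definition coadjoint : tm 1 2 := (idH ⋄ (m ∘ (SH ⋄ idH))) ∘ (γ ⋄ idH) ∘ (idH ⋄ Δ) ∘ Δ.

(** Put the strand of [W_central] on a leg of a second copy of W and comultiply:
    [W_comulL] and [W_comulR] turn both sides into products of three copies of W, a
    Yang-Baxter equation, and the added leg can be cancelled. *)
Lemma W_exchange : mulHH ∘ (Δ ⋄ W) ≡
  (m ⋄ m) ∘ (idH ⋄ γ ⋄ idH) ∘ (γ ⋄ Id 2) ∘ (idH ⋄ γbar ⋄ idH) ∘ (Δ ⋄ W).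
Proof.
apply: Esym; apply: W_cancel.
via (fun x => (idH ⋄ m ⋄ m) ∘ (Id 2 ⋄ γ ⋄ idH) ∘ (idH ⋄ γ ⋄ Id 2) ∘ (Id 2 ⋄ γbar ⋄ idH) ∘
  (x ⋄ W)) W_comulR.
apply: Esym.
via (fun x => (idH ⋄ mulHH) ∘ (x ⋄ W)) W_comulR.
apply: Esym.
via (fun x => (mulHH ⋄ idH) ∘ (Id 2 ⋄ W ⋄ idH) ∘ x) (Esym W_comulL).
via (fun x => (x ⋄ idH) ∘ W) W_central.
via (fun x => (mulHH ⋄ idH) ∘ (W ⋄ Id 3) ∘ x) W_comulL.
by_diagram.
Qed.

Lemma W_absorb : (m ⋄ idH) ∘ (idH ⋄ γ) ∘ (W ⋄ idH) ≡ mulHH ∘ (coadjoint ⋄ W).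
Proof.
apply: Esym.
via (fun x => (idH ⋄ m) ∘ (γ ⋄ idH) ∘ (SH ⋄ x) ∘ Δ) W_exchange.
via (fun x => (m ⋄ m) ∘ (idH ⋄ γ ⋄ idH) ∘ (γ ⋄ Id 2) ∘ (idH ⋄ γbar ⋄ idH) ∘
  (((x ⋄ idH) ∘ Δ) ⋄ W)) antipodeL.
by_diagram.
Qed.

(** x(1) y S(x(2)) x(3) = x y, by the antipode. *)
Lemma mul_adjoint : m ∘ (α1 ⋄ idH) ∘ (idH ⋄ γ) ∘ (Δ ⋄ idH) ≡ m.
Proof.
via (fun x => m ∘ (m ⋄ idH) ∘ (Id 2 ⋄ x) ∘ (idH ⋄ γ) ∘ (Δ ⋄ idH)) antipodeL.
by_diagram.
Qed.

(** W is invertible, with inverse σ. *)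
Lemma mulHH_W_inj (f g : tm 1 2) : mulHH ∘ (f ⋄ W) ≡ mulHH ∘ (g ⋄ W) -> f ≡ g.
Proof.
have K : (mulHH ∘ (Id 2 ⋄ σ)) ∘ (mulHH ∘ (Id 2 ⋄ W)) ≡ Id 2.
  via (fun x => mulHH ∘ (Id 2 ⋄ x)) mul_W_σ.
  by_diagram.
have H (h : tm 1 2) : h ≡ (mulHH ∘ (Id 2 ⋄ σ)) ∘ (mulHH ∘ (h ⋄ W)).
  have e : mulHH ∘ (h ⋄ W) ≡ (mulHH ∘ (Id 2 ⋄ W)) ∘ h.
    refine (Etrans (comp_congr (Erefl mulHH) (Etrans (Esym (ten_lr h W))
      (comp_congr (Erefl (Id 2 ⋄ W)) _))) (compA mulHH (Id 2 ⋄ W) h)).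
    by have := @law_tenf1 _ _ EL _ _ h; rewrite castmE.
  refine (Etrans (Esym (comp1f h)) (Etrans (comp_congr (Esym K) (Erefl h)) _)).
  exact (Etrans (Esym (compA _ _ h)) (comp_congr (Erefl _) (Esym e))).
move=> e; refine (Etrans (H f) (Etrans _ (Esym (H g)))).
exact (comp_congr (Erefl _) e).
Qed.

(** Multiplied by W, both sides become the product of the first leg of W with the
    strand: the left one by [mul_adjoint], the right one by [W_absorb]. *)
Lemma adjoint_W : (α1 ⋄ idH) ∘ (idH ⋄ γ) ∘ (W ⋄ idH) ≡ coadjoint.
Proof.
apply: mulHH_W_inj; apply: Etrans _ W_absorb; apply: Esym.
via (fun x => (x ⋄ idH) ∘ (idH ⋄ γ) ∘ (W ⋄ idH)) (Esym mul_adjoint).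
via (fun x => ((m ∘ (α1 ⋄ idH) ∘ (idH ⋄ γ)) ⋄ idH) ∘ (Id 2 ⋄ γ) ∘ (x ⋄ idH)) W_comulL.
by_diagram.
Qed.

(** * The mirror image of the adjoint action *)

(** x ⋄ y ↦ x(2) y SbarH(x(1)), where x(1) passes under the rest. *)
Definition mirror_α1 : tm 2 1 := m ∘ (m ⋄ SbarH) ∘ (idH ⋄ γbar) ∘ (γbar ⋄ idH) ∘ (Δ ⋄ idH).

(** In Sweedler notation and up to the braiding, a(x(1), y) ⋄ x(2) = a(x(2), y) ⋄ x(1):
    from the point of view of a, the comultiplication is cocommutative. *)
Definition cocommutes (a : tm 2 1) :=
  (a ⋄ idH) ∘ (idH ⋄ γ) ∘ (Δ ⋄ idH) ≡ γbar ∘ (idH ⋄ a) ∘ (Δ ⋄ idH).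

(** Multiplying the two outputs turns the left side into x y by
    [mul_adjoint].  The right side becomes (x(2) ▷ y) x(1) up to the braiding,
    which the skew antipode solves for x ▷ y, giving the mirror action. *)
Lemma cocommutes_mirror_eq : cocommutes α1 -> mirror_α1 ≡ α1.
Proof.
move=> h.
have e : m ∘ γbar ∘ (idH ⋄ α1) ∘ (Δ ⋄ idH) ≡ m.
  via (fun x => m ∘ x) (Esym h).
  via (fun x => x) mul_adjoint; exact: Erefl.
apply: Esym.
via (fun x => m ∘ (α1 ⋄ idH) ∘ (idH ⋄ γbar) ∘ (γbar ⋄ idH) ∘ (((x ⋄ idH) ∘ Δ) ⋄ idH))
  (Esym skew_antipodeL).
via (fun x => m ∘ (x ⋄ SbarH) ∘ (idH ⋄ γbar) ∘ (γbar ⋄ idH) ∘ (Δ ⋄ idH)) e.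
by_diagram.
Qed.

(** The same argument with the roles of the two actions exchanged. *)
Lemma mirror_cocommutes_eq : cocommutes mirror_α1 -> mirror_α1 ≡ α1.
Proof.
move=> h.
have e : m ∘ (mirror_α1 ⋄ idH) ∘ (idH ⋄ γ) ∘ (Δ ⋄ idH) ≡ m.
  via (fun x => m ∘ x) h.
  via (fun x => m ∘ (m ⋄ x) ∘ (idH ⋄ γbar) ∘ (γbar ⋄ idH) ∘ (Δ ⋄ idH)) skew_antipodeR.
  by_diagram.
via (fun x => m ∘ (mirror_α1 ⋄ x) ∘ (idH ⋄ γ) ∘ (Δ ⋄ idH)) (Esym antipodeR).
via (fun x => m ∘ (x ⋄ SH) ∘ (idH ⋄ γ) ∘ (Δ ⋄ idH)) e.
by_diagram.
Qed.

Lemma cocommutes_iff_mirror : cocommutes α1 <-> cocommutes mirror_α1.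
Proof.
split=> h.
- have e := cocommutes_mirror_eq h; rewrite /cocommutes.
  via (fun x => (x ⋄ idH) ∘ (idH ⋄ γ) ∘ (Δ ⋄ idH)) e.
  via (fun x => x) h.
  via (fun x => γbar ∘ (idH ⋄ x) ∘ (Δ ⋄ idH)) (Esym e).
  by_diagram.
- have e := Esym (mirror_cocommutes_eq h); rewrite /cocommutes.
  via (fun x => (x ⋄ idH) ∘ (idH ⋄ γ) ∘ (Δ ⋄ idH)) e.
  via (fun x => x) h.
  via (fun x => γbar ∘ (idH ⋄ x) ∘ (Δ ⋄ idH)) (Esym e).
  by_diagram.
Qed.

(** * The axiom r9 *)

(** A simplified form of the left side of r9, see [r9_lhs]. *)
Definition mirror_braiding : tm 2 2 := (mirror_α1 ⋄ idH) ∘ (idH ⋄ γbar) ∘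
  ((γbar ∘ coadjoint) ⋄ idH).

(** The coaction contains a factor S(x(1)).  Composing with x(1) releases it
    on one side and produces cocommutation on the other. *)
Lemma mirror_braiding_cocommutes : mirror_braiding ≡ γ <-> cocommutes mirror_α1.
Proof.
split=> h.
- rewrite /cocommutes.
  via (fun x => (mirror_α1 ⋄ idH) ∘ (idH ⋄ x) ∘ (Δ ⋄ idH)) (Esym h).
  via (fun x => (mirror_α1 ⋄ idH) ∘ (m ⋄ γbar) ∘ (idH ⋄ γbar ⋄ idH) ∘ (((x ⋄ Δ) ∘ Δ) ⋄ idH))
    antipodeR.
  by_diagram.
- via (fun x => (mirror_α1 ⋄ idH) ∘ (SH ⋄ x) ∘ (Δ ⋄ idH)) (Esym h).
  via (fun x => (mirror_α1 ⋄ idH) ∘ (idH ⋄ γ) ∘ (((x ⋄ idH) ∘ Δ) ⋄ idH)) antipodeL.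
  by_diagram.
Qed.

Lemma γbar_σ : γbar ∘ σ ≡ ((SH ∘ SH) ⋄ SH) ∘ W.
Proof. via (fun x => γbar ∘ (idH ⋄ SH) ∘ x) W_flip. by_diagram. Qed.

(** (x, x', y) ↦ S(x') y S(S(x)); on the two legs of Δ(x) this is
    S(x) ▷ y. *)
Definition antipode_sandwich : tm 3 1 := m ∘ (m ⋄ idH) ∘ (SH ⋄ idH ⋄ (SH ∘ SH)) ∘ (idH ⋄ γ) ∘
  (γ ⋄ idH).

(** The two copairings that meet the same strand merge into one by [W_comulR], and
    the leg that carries both acts on the strand by the adjoint action. *)
Lemma r9_lhs_left : (m ⋄ idH) ∘ (SH ⋄ (γbar ∘ μ)) ∘ (ρl ⋄ idH) ≡
  (m ⋄ idH) ∘ (SH ⋄ γbar) ∘ (idH ⋄ (α1 ∘ (SH ⋄ idH)) ⋄ idH) ∘ (W ⋄ Id 2).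
Proof.
pose m3 := m ∘ (m ⋄ idH).
via (fun x => (m3 ⋄ m3) ∘ (Id 2 ⋄ γbar ⋄ Id 2) ∘ (Id 3 ⋄ γbar ⋄ idH) ∘ (Id 4 ⋄ γbar) ∘
  (idH ⋄ γbar ⋄ Id 3) ∘ (Id 2 ⋄ γbar ⋄ Id 2) ∘ (((SH ⋄ idH) ∘ σ) ⋄ idH ⋄ x ⋄ idH)) γbar_σ.
via (fun x => (m3 ⋄ m3) ∘ (Id 2 ⋄ γbar ⋄ Id 2) ∘ (Id 3 ⋄ γbar ⋄ idH) ∘ (Id 4 ⋄ γbar) ∘
  (idH ⋄ γbar ⋄ Id 3) ∘ (Id 2 ⋄ γbar ⋄ Id 2) ∘ (((SH ⋄ idH) ∘ σ) ⋄ idH ⋄ ((SH ⋄ SH) ∘ x) ⋄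
  idH)) W_antipode_slide.
via (fun x => (m ⋄ idH) ∘ (SH ⋄ γbar) ∘ (idH ⋄ antipode_sandwich ⋄ idH) ∘ (x ⋄ Id 2))
  (Esym W_comulR).
by_diagram.
Qed.

Lemma r9_lhs_right : (m ⋄ m) ∘ (idH ⋄ σ ⋄ (m ∘ (idH ⋄ SH))) ∘ (γbar ⋄ idH) ∘ (idH ⋄ σ) ≡
  (idH ⋄ (α1 ∘ (SH ⋄ idH))) ∘ (W ⋄ idH).
Proof.
via (fun x => (idH ⋄ antipode_sandwich) ∘ (x ⋄ idH)) (Esym W_comulR).
by_diagram.
Qed.

(** After [r9_lhs_left] and [r9_lhs_right] two copies of W remain; [W_comulL] merges
    them into one, whose leg acts by α1, so that [adjoint_W] eliminates it. *)
Lemma r9_lhs : (m ⋄ m) ∘ (SH ⋄ (μ ∘ γbar ∘ μ) ⋄ SH) ∘ (ρl ⋄ ρr) ≡ mirror_braiding.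
Proof.
have e : (Id 3 ⋄ (m ∘ γbar) ⋄ idH) ∘ (Id 2 ⋄ W ⋄ Id 2) ∘ (idH ⋄ γbar ⋄ idH) ∘ (Id 2 ⋄ γbar) ∘
  (W ⋄ Id 2) ≡
  (idH ⋄ γbar ⋄ Id 2) ∘ (Id 2 ⋄ γbar ⋄ idH) ∘ (Id 3 ⋄ γbar) ∘ (((Δ ⋄ idH) ∘ W) ⋄ Id 2).
  via (fun x => (idH ⋄ γbar ⋄ Id 2) ∘ (Id 2 ⋄ γbar ⋄ idH) ∘ (Id 3 ⋄ γbar) ∘ (x ⋄ Id 2))
    (Esym W_comulL).
  exact: Erefl.
via (fun x => (m ⋄ idH) ∘ (idH ⋄ x) ∘ ((m ⋄ idH) ∘ (SH ⋄ (γbar ∘ μ)) ∘ (ρl ⋄ idH)))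
  r9_lhs_right.
via (fun x => (m ⋄ idH) ∘ (idH ⋄ ((idH ⋄ (α1 ∘ (SH ⋄ idH))) ∘ (W ⋄ idH))) ∘ x) r9_lhs_left.
via (fun x => ((m ∘ (m ⋄ idH)) ⋄ α1) ∘ (SH ⋄ Id 2 ⋄ SH ⋄ idH) ∘ x) e.
via (fun x => ((m ∘ (m ⋄ idH)) ⋄ α1) ∘ (SH ⋄ Id 2 ⋄ SH ⋄ idH) ∘ (idH ⋄ γbar ⋄ Id 2) ∘
  (Id 2 ⋄ γbar ⋄ idH)
  ∘ (Id 3 ⋄ γbar) ∘ (((Δ ⋄ idH) ∘ x) ⋄ Id 2)) W_flip_skew.
via (fun x => (mirror_α1 ⋄ idH) ∘ (idH ⋄ γbar) ∘ ((γbar ∘ x) ⋄ idH)) adjoint_W.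
by_diagram.
Qed.

Lemma r9_cocommutes : holds E ax_r9 <-> cocommutes α1.
Proof.
split=> h.
  by apply/cocommutes_iff_mirror/mirror_braiding_cocommutes; exact: Etrans (Esym r9_lhs) h.
by move/cocommutes_iff_mirror/mirror_braiding_cocommutes: h; exact: Etrans r9_lhs.
Qed.

(** * Consequences of cocommutation *)

(** Write x ▷ σ for the action of x on both legs.  By cocommutation
    (x(1) ▷ σ) Δ(x(2)) is Δ(x) σ, and this is σ Δ(x) as σ is central; the antipode
    removes the factor Δ(x(2)). *)
Lemma cocommutes_q : cocommutes α1 -> holds E ax_q.
Proof.
move=> h; rewrite /holds /=.
have e : mulHH ∘ ((α2 ∘ (idH ⋄ σ)) ⋄ Δ) ∘ Δ ≡ mulHH ∘ (σ ⋄ Δ).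
  via (fun x => (m ⋄ m) ∘ (α1 ⋄ (γ ∘ x) ⋄ idH) ∘ (Id 3 ⋄ γ) ∘ (idH ⋄ γ ⋄ Id 2) ∘
    (Id 2 ⋄ γ ⋄ idH) ∘ (((idH ⋄ Δ) ∘ Δ) ⋄ σ)) h.
  via (fun x => (x ⋄ (m ∘ (α1 ⋄ idH) ∘ (idH ⋄ γ) ∘ (Δ ⋄ idH))) ∘ (idH ⋄ γ ⋄ idH) ∘ (Δ ⋄ σ))
    mul_adjoint.
  via (fun x => (m ⋄ x) ∘ (idH ⋄ γ ⋄ idH) ∘ (Δ ⋄ σ)) mul_adjoint.
  via (fun x => x) σ_central.
  exact: Erefl.
via (fun x => mulHH ∘ ((α2 ∘ (idH ⋄ σ)) ⋄ (Δ ∘ x)) ∘ Δ) (Esym antipodeR).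
via (fun x => mulHH ∘ (x ⋄ (Δ ∘ SH)) ∘ Δ) e.
via (fun x => mulHH ∘ (σ ⋄ (Δ ∘ x))) antipodeR.
by_diagram.
Qed.

(** Written with the mirror action, S(S(x(2))) ▷ x(1) contains the product
    x(1) S(x(2)), in which the antipode cancels. *)
Lemma adjoint_antipode_sq : cocommutes α1 -> α1 ∘ ((SH ∘ SH) ⋄ idH) ∘ γ ∘ Δ ≡ SH ∘ SH.
Proof.
move=> /cocommutes_mirror_eq e.
via (fun x => x ∘ ((SH ∘ SH) ⋄ idH) ∘ γ ∘ Δ) (Esym e).
via (fun x => m ∘ ((SH ∘ SH) ⋄ x) ∘ γ ∘ Δ) antipodeR.
by_diagram.
Qed.

(** Cocommutation lets the acting strand be carried around the other one, which
    turns SbarH into SH. *)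
Lemma adjoint_full_twist : cocommutes α1 -> α1 ∘ (SbarH ⋄ idH) ∘ γbar ∘ γbar ≡ α1 ∘ (SH ⋄ idH).
Proof.
move=> h.
have e1 : Id 2 ≡ (idH ⋄ α1) ∘ (Δ ⋄ idH) ∘ (idH ⋄ (α1 ∘ (SH ⋄ idH))) ∘ (Δ ⋄ idH).
  via (fun x => (idH ⋄ (α1 ∘ (x ⋄ idH))) ∘ (Δ ⋄ idH)) (Esym antipodeR).
  by_diagram.
have e2 : α1 ∘ (SbarH ⋄ idH) ∘ γbar ∘ ((α1 ⋄ idH) ∘ (idH ⋄ γ) ∘ (Δ ⋄ idH)) ≡ ε ⋄ idH.
  via (fun x => α1 ∘ (x ⋄ idH)) skew_antipodeR.
  by_diagram.
via (fun x => α1 ∘ (SbarH ⋄ idH) ∘ γbar ∘ γbar ∘ x) e1.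
via (fun x => α1 ∘ (SbarH ⋄ idH) ∘ γbar ∘ x ∘ (idH ⋄ (α1 ∘ (SH ⋄ idH))) ∘ (Δ ⋄ idH)) (Esym h).
via (fun x => x ∘ (idH ⋄ (α1 ∘ (SH ⋄ idH))) ∘ (Δ ⋄ idH)) e2.
by_diagram.
Qed.

Lemma adjoint_comul : cocommutes α1 -> α1 ∘ γbar ∘ Δ ≡ SH ∘ SH.
Proof.
move=> h.
via (fun x => x ∘ (SH ⋄ idH) ∘ γ ∘ Δ) (adjoint_full_twist h).
via (fun x => x) (adjoint_antipode_sq h).
exact: Erefl.
Qed.

(** [adjoint_comul] transported through cocommutation. *)
Lemma coadjoint_exchange : cocommutes α1 -> (idH ⋄ (SH ∘ SH)) ∘ γ ∘ Δ ≡ (idH ⋄ α1) ∘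
  (Δ ⋄ idH) ∘ γbar ∘ Δ.
Proof.
move=> h; apply: Esym.
via (fun x => γ ∘ x ∘ γbar ∘ Δ) (Esym h).
via (fun x => γ ∘ (x ⋄ idH) ∘ Δ) (adjoint_comul h).
by_diagram.
Qed.

(** x ↦ x(2) ⋄ x(1) S(x(3)), where x(1) passes under x(2). *)
Definition skew_coadjoint : tm 1 2 := (idH ⋄ (m ∘ (idH ⋄ SH))) ∘ (γbar ⋄ idH) ∘ (idH ⋄ Δ) ∘ Δ.

(** σ is W with an antipode on a leg, so [adjoint_W] applies; [coadjoint_exchange]
    then brings the coaction to the form in which the antipode cancels. *)
Lemma adjoint_σ : cocommutes α1 -> (α1 ⋄ idH) ∘ (idH ⋄ γ) ∘ (σ ⋄ idH) ≡ skew_coadjoint.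
Proof.
move=> h.
via (fun x => (idH ⋄ SH) ∘ x) adjoint_W.
via (fun x => (idH ⋄ (m ∘ (SH ⋄ idH))) ∘ (Δ ⋄ idH) ∘ x) (coadjoint_exchange h).
via (fun x => (idH ⋄ (m ∘ (m ⋄ SH))) ∘ (Id 2 ⋄ γ) ∘ (((idH ⋄ ((x ⋄ idH) ∘ Δ)) ∘ Δ) ⋄ idH) ∘
  γbar ∘ Δ) antipodeL.
by_diagram.
Qed.

(** By [mul_σ_Δ] the left side is r8 up to the invertible vbar ⋄ vbar. *)
Lemma r8_of_σ_Δ : mulHH ∘ (σ ⋄ Δ) ≡ μ ∘ γbar ∘ Δ -> holds E ax_r8.
Proof.
move=> h; rewrite /holds /=.
via (fun x => (vbar ⋄ vbar) ∘ x) (Esym mul_σ_Δ).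
via (fun x => (vbar ⋄ vbar) ∘ x) h.
by_diagram.
Qed.

(** In the first factor of σ Δ write the product by [mul_adjoint]; r7 separates
    the leg that acts from the one that is multiplied, [adjoint_σ] trades the action for a
    coaction, and the antipode in the coaction cancels. *)
Lemma cocommutes_r8 : cocommutes α1 -> holds E ax_r8.
Proof.
move=> h; apply: r8_of_σ_Δ.
via (fun x => (x ⋄ m) ∘ (idH ⋄ γ ⋄ idH) ∘ (σ ⋄ Δ)) (Esym mul_adjoint).
via (fun x => ((m ∘ (α1 ⋄ idH) ∘ (idH ⋄ γ)) ⋄ m) ∘ (Id 2 ⋄ γ ⋄ idH) ∘ (x ⋄ Δ)) comulL_copairing.
via (fun x => (m ⋄ m) ∘ (idH ⋄ σ ⋄ m) ∘ (x ⋄ idH) ∘ Δ) (adjoint_σ h).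
via (fun x => μ ∘ (idH ⋄ m) ∘ (γbar ⋄ idH) ∘ (idH ⋄ ((idH ⋄ x) ∘ Δ)) ∘ Δ) antipodeL.
by_diagram.
Qed.

End Relation.

(** * Equivalence of the presentations *)

Lemma qh_of_selfdual (E : tm_rel) : braided_congr E ->
  (forall x, selfdual_ax x -> holds E x) -> forall x, selfdual_ax_qh x -> holds E x.
Proof.
move=> EL EA x; have EA' y : selfdual_ax y -> y <> ax_r8 -> y <> ax_r9 ->
  holds E y by move=> /EA.
have h : cocommutes E α1 by apply/(r9_cocommutes EL EA'); exact: EA.
case: x => // _; try exact: EA.
exact: cocommutes_q h.
Qed.

Lemma selfdual_of_qh (E : tm_rel) : braided_congr E ->
  (forall x, selfdual_ax_qh x -> holds E x) -> forall x, selfdual_ax x -> holds E x.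
Proof.
move=> EL EA x.
have EA' y : selfdual_ax y -> y <> ax_r8 -> y <> ax_r9 -> holds E y.
  by case: y => // _ h8 h9; exact: EA.
have h : cocommutes E α1 by exact: (EA ax_h10).
case: x => // _; try exact: EA; first exact: cocommutes_r8 h.
exact/(r9_cocommutes EL EA').
Qed.

Definition id_functor (A B : ax -> bool)
  (AB : forall a b (f g : tm a b), generated A f g -> generated B f g) :
  sbm_functor (presented A) (presented B).
Proof.
refine (@SbmFunctor (presented A) (presented B) id (fun a b f => f) erefl (fun a b => erefl) AB
  _ _ _ _).
- by move=> a; exact: (law_refl (generated_laws B)).
- by move=> a b c f g; exact: (law_refl (generated_laws B)).
- by move=> a b c d f g; exact: (law_refl (generated_laws B)).
- by move=> a b; exact: (law_refl (generated_laws B)).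
Defined.

Definition id_unit A B AB BA : unit_iso (@id_functor A B AB) (@id_functor B A BA).
Proof.
have GL := generated_laws A.
refine (@UnitIso (presented A) (presented B) (id_functor AB) (id_functor BA)
  (fun a => Id a) (fun a => Id a) _ _ _ _ _).
- by move=> a; exact: (law_comp1f GL).
- by move=> a; exact: (law_comp1f GL).
- by move=> a b f; exact: (law_trans GL (law_compf1 GL f) (law_sym GL (law_comp1f GL f))).
- exact: (law_refl GL).
- by move=> a b; exact: (law_sym GL (law_ten_id GL a b)).
Defined.

Theorem proposition3p3 :
  (forall E : tm_rel, braided_congr E ->
     (forall x : ax, selfdual_ax x -> x <> ax_r8 -> holds E x) ->
     (holds E ax_r8 <-> holds E ax_q)) /\
  (forall E : tm_rel, braided_congr E ->
     (forall x : ax, selfdual_ax x -> x <> ax_r9 -> holds E x) ->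
     (holds E ax_r9 <-> holds E ax_h10)) /\
  (exists eqv : sbm_equiv (presented selfdual_ax) (presented selfdual_ax_qh),
     preserves_elem (efun eqv) /\ preserves_elem (einv eqv)).
Proof.
split; [|split].
- move=> E EL EA.
  have EA' y : selfdual_ax y -> y <> ax_r8 -> y <> ax_r9 -> holds E y by move=> self h8 _;
    exact: EA.
  have h : cocommutes E α1 by apply/(r9_cocommutes EL EA'); exact: EA.
  (* As r9 implies h10, both sides of the equivalence hold. *)
  by split=> _; [exact: cocommutes_q h | exact: cocommutes_r8 h].
- move=> E EL EA; apply: r9_cocommutes => // y self _; exact: EA.
- have AB a b (f g : tm a b) : generated selfdual_ax f g -> generated selfdual_ax_qh f g.
    by move=> fg E EL /(selfdual_of_qh EL); exact: fg.
  have BA a b (f g : tm a b) : generated selfdual_ax_qh f g -> generated selfdual_ax f g.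
    by move=> fg E EL /(qh_of_selfdual EL); exact: fg.
  exists (SbmEquiv (id_unit AB BA) (id_unit BA AB)).
  by split; exists (fun k => erefl) => a b e; exact: (law_refl (generated_laws _)).
Qed.
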